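(* Let $K$, $I$, $J$ be nonempty finite sets and let $f : K \times (I\times J)^{\mathbb{N}} \to \mathbb{R}$ be bounded and Borel measurable. For $p \in \Delta(K)$ let $\underline{v}(p)$ denote the maxmin value of the two-player zero-sum repeated game with incomplete information on one side $\Gamma(p) = (K,I,J,p,f)$, let $u(p)$ denote the value of the non-revealing game $\Gamma^{\rm NR}(p)$, and let $\operatorname{cav} u$ denote the concavification of the function $u : \Delta(K) \to \mathbb{R}$. If $f$ is tail measurable, then $$\underline{v}(p) = (\operatorname{cav} u)(p) \quad \text{for every } p \in \Delta(K).$$
   Context: Notation: $\mathbb{N} = \{0,1,2,\ldots\}$. For a finite set $X$, $\Delta(X)$ is the set of probability distributions on $X$. $(I\times J)^0$ is the singleton containing the empty history. $K\times(I\times J)^{\mathbb{N}}$ carries the product topology of discrete finite sets and the corresponding product (Borel) sigma-algebra. The game $\Gamma(p)$: $K$ is the set of states of nature, $I$ and $J$ are the action sets of Players I and II, $p\in\Delta(K)$ is the prior, and $f$ is the payoff function. Nature selects a state $k^*\in K$ according to $p$ and reveals $k^*$ to Player I but not to Player II. At every stage $t\in\mathbb{N}$ the two players, after observing all past actions, simultaneously select actions $i_t\in I$ and $j_t\in J$. The payoff, which Player I maximizes and Player II minimizes, is $f(k^*,i_0,j_0,i_1,j_1,\ldots)$. Strategies: a strategy of Player I is a function $\sigma : K\times\left(\bigcup_{t\in\mathbb{N}}(I\times J)^t\right)\to\Delta(I)$; a strategy of Player II is a function $\tau:\bigcup_{t\in\mathbb{N}}(I\times J)^t\to\Delta(J)$.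 Let $\mathcal{S}$ and $\mathcal{T}$ be the sets of strategies of Players I and II. A pair $(\sigma,\tau)$ together with $p$ induces a probability distribution $\mathbb{P}_{p,\sigma,\tau}$ on $K\times(I\times J)^{\mathbb{N}}$: $k^*$ is drawn from $p$ and, at each stage, given $k^*$ and the past action pairs $h$, the actions are drawn independently from $\sigma(k^*,h)$ and $\tau(h)$. Its expectation is denoted $\mathbf{E}_{p,\sigma,\tau}$. Maxmin value: $\underline{v}(p)=\sup_{\sigma\in\mathcal{S}}\inf_{\tau\in\mathcal{T}}\mathbf{E}_{p,\sigma,\tau}[f]$. Non-revealing game: $\Gamma^{\rm NR}(p)$ is the game that is the same as $\Gamma(p)$ except that neither player is told $k^*$, so that a strategy of Player I is a function $\sigma:\bigcup_{t\in\mathbb{N}}(I\times J)^t\to\Delta(I)$. Equivalently, it is the two-player zero-sum repeated game with complete information, action sets $I$ and $J$, and payoff function $\sum_{k\in K}p(k)f(k,\cdot)$ on $(I\times J)^{\mathbb{N}}$. By a theorem of Martin (1998), this game has a value (its sup-inf and inf-sup over strategies coincide); this value is $u(p)$. Concavification: $\operatorname{cav}u$ is the least real-valued concave function on $\Delta(K)$ that is larger than or equal to $u$. Tail measurability: $f$ is tail measurable if $f(k,i_0,j_0,i_1,j_1,\ldots)=f(k,i'_0,j'_0,i'_1,j'_1,\ldots)$ for every $k\in K$ and every two sequences $(i_0,j_0,i_1,j_1,\ldots),(i'_0,j'_0,i'_1,j'_1,\ldots)\in(I\times J)^{\mathbb{N}}$ that differ in only finitely many coordinates. *)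

(* Defs.v *)
From HB Require Import structures.
From mathcomp Require Import all_boot all_order all_algebra.
From mathcomp Require Import interval_inference.
From mathcomp Require Import all_classical all_reals all_analysis.

Set Implicit Arguments.
Unset Strict Implicit.
Unset Printing Implicit Defensive.

Import Order.TTheory GRing.Theory Num.Theory.
Import numFieldNormedType.Exports.

Local Open Scope classical_set_scope.
Local Open Scope ring_scope.

(* A nonempty finite set, in the pointed encoding of mathcomp-analysis *)
#[short(type="pfinType")]
HB.structure Definition PointedFinite := {T of Finite T & isPointed T}.

(* Delta(T); the codomain R^o makes {ffun T -> R^o} an R-module, from which
   dist R T inherits its structure of convex space *)
Record dist (R : numDomainType) (T : finType) : Type := Dist {
  dist_ffun :> {ffun T -> R^o};
  _ : [forall x, 0 <= dist_ffun x] && (\sum_x dist_ffun x == 1) }.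

HB.instance Definition _ (R : numDomainType) (T : finType) :=
  [isSub for @dist_ffun R T].
HB.instance Definition _ (R : numDomainType) (T : finType) :=
  [Choice of dist R T by <:].

Lemma dist_ge0 (R : numDomainType) (T : finType) (p : dist R T) x : 0 <= p x.
Proof. by case: p => f /= /andP[/forallP]. Qed.

Lemma dist_sum1 (R : numDomainType) (T : finType) (p : dist R T) :
  \sum_x p x = 1.
Proof. by case: p => f /= /andP[_ /eqP]. Qed.

Section dist_convex.
Variables (R : realType) (T : finType).
Local Open Scope convex_scope.
Implicit Types (t : {i01 R}) (p q : dist R T).

Let E := convex_lmodType {ffun T -> R^o}.

Let mix t p q : {ffun T -> R^o} := (dist_ffun p : E) <| t |> (dist_ffun q : E).

Fact dist_mix_subproof t p q :
  [forall x, 0 <= mix t p q x] && (\sum_x mix t p q x == 1).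
Proof.
have mE x : mix t p q x = t%:inum * p x + (1 - t%:inum) * q x by rewrite !ffunE.
apply/andP; split.
  by apply/forallP => x; rewrite mE addr_ge0 // mulr_ge0 ?dist_ge0.
under eq_bigr do rewrite mE.
by rewrite big_split /= -!mulr_sumr !dist_sum1 !mulr1 addrC subrK.
Qed.

Definition dist_mix t p q : dist R T := Dist (dist_mix_subproof t p q).

Fact dist_mix1 p q : dist_mix 1%:i01 p q = p.
Proof. by apply/val_inj; exact: (@conv1 R E). Qed.
Fact dist_mixmm t p : dist_mix t p p = p.
Proof. by apply/val_inj; exact: (@convmm R E). Qed.
Fact dist_mixC t p q :
  dist_mix t p q = dist_mix (1 - t%:inum)%:i01 q p.
Proof. by apply/val_inj; exact: (@convC R E). Qed.
Fact dist_mixA : convex_quasi_associative dist_mix.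
Proof. by move=> p q r s a b c prs spq; apply/val_inj; exact: (@convA R E). Qed.

HB.instance Definition _ := isConvexSpace.Build R (dist R T)
  dist_mix1 dist_mixmm dist_mixC dist_mixA.

End dist_convex.

Section concavification.
Variables (R : realType) (T : convType R).
Local Open Scope convex_scope.
Implicit Types u g : T -> R.

Definition concave g := forall (t : {i01 R}) (p q : T),
  (g p : R^o) <| t |> g q <= g (p <| t |> q).

(* Pointwise infimum of the concave majorants of u; it is the least concave
   majorant whenever u is bounded above (cav_least) *)
Definition cav u (p : T) : R :=
  inf [set g p | g in [set g | concave g /\ forall q, u q <= g q]].

Lemma cav_least u : (exists M, forall q, u q <= M) ->
  [/\ concave (cav u), forall q, u q <= cav u q &
      forall g, concave g -> (forall q, u q <= g q) -> forall q, cav u q <= g q].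
Proof.
move=> [M uM].
have cM : concave (fun=> M) by move=> t p q; rewrite convmm.
have ne p : [set g p | g in [set g | concave g /\ forall q, u q <= g q]] !=set0.
  by exists M, (fun=> M).
have lb p : lbound [set g p | g in [set g | concave g /\ forall q, u q <= g q]]
    (u p).
  by move=> _ [g [_ ug] <-].
have le g p : concave g -> (forall q, u q <= g q) -> cav u p <= g p.
  by move=> cg ug; apply: ge_inf; [exists (u p)|exists g].
split=> [t p q|q|g cg ug q]; [|exact: lb_le_inf|exact: le].
apply: lb_le_inf => // _ [g [cg ug] <-].
apply: le_trans (cg t p q); rewrite !convRE.
by rewrite lerD // ler_wpM2l ?le // subr_ge0.
Qed.

End concavification.

Section plays.
Variables (K I J : pfinType).

(* The product topology on K * (I * J)^nat (all factors discrete) has the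
   cylinders as a countable base, so they generate its Borel sigma-algebra,
   which is also the product sigma-algebra *)
Definition cylinder (k : K) (w : nat -> I * J) (n : nat) :
    set (K * (nat -> I * J)) :=
  [set x | x.1 = k /\ forall t, (t < n)%N -> x.2 t = w t].

Definition cylinders : set (set (K * (nat -> I * J))) :=
  [set C | exists k w n, C = cylinder k w n].

Definition play := g_sigma_algebraType cylinders.

HB.instance Definition _ := Measurable.on play.

Lemma measurable_cylinder k w n : measurable (cylinder k w n : set play).
Proof. by apply: sub_sigma_algebra; exists k, w, n. Qed.

End plays.

Section sampling.
Variables (R : realType) (A : finType) (a0 : A) (q : seq A -> dist R A).
Implicit Types (w : nat -> A) (n : nat) (x : R).

(* A point drawn from the Lebesgue measure on [0, 1[ is turned into a sequence
   over A: each prefix of length n owns an interval whose length is its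
   probability, cut according to q to obtain the intervals of its extensions *)
Let cum (h : seq A) m : R := \sum_(0 <= i < m) q h (nth a0 (enum A) i).

Let rk (a : A) := index a (enum A).

Let cumS h a : cum h (rk a).+1 = cum h (rk a) + q h a.
Proof. by rewrite /cum big_nat_recr //= nth_index ?mem_enum. Qed.

Let cum_le h m n : (m <= n)%N -> cum h m <= cum h n.
Proof.
move=> mn; rewrite /cum (big_cat_nat (leq0n m) mn) //= lerDl.
by apply: sumr_ge0 => i _; exact: dist_ge0.
Qed.

Let cum_card h : cum h (size (enum A)) = 1.
Proof.
rewrite /cum -(big_nth a0 predT (fun a => q h a)) big_enum.
exact: dist_sum1.
Qed.

Let len w n : R := \prod_(t < n) q (mkseq w t) (w t).

Let lo w n : R := \sum_(t < n) len w t * cum (mkseq w t) (rk (w t)).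

Let cell w n : set R := `[lo w n, lo w n + len w n[.

Let len_ge0 w n : 0 <= len w n.
Proof. by apply: prodr_ge0 => t _; exact: dist_ge0. Qed.

Let cellE w n x : cell w n x = (lo w n <= x < lo w n + len w n) :> Prop.
Proof. by rewrite /cell /= in_itv. Qed.

Let lenS w n : len w n.+1 = len w n * q (mkseq w n) (w n).
Proof. by rewrite /len big_ord_recr. Qed.

Let loS w n : lo w n.+1 = lo w n + len w n * cum (mkseq w n) (rk (w n)).
Proof. by rewrite /lo big_ord_recr. Qed.

Let hiS w n : lo w n.+1 + len w n.+1 =
  lo w n + len w n * cum (mkseq w n) (rk (w n)).+1.
Proof. by rewrite loS lenS cumS mulrDr addrA. Qed.

Let eq_mkseq_lt w w' n : (forall t, (t < n)%N -> w t = w' t) ->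
  mkseq w n = mkseq w' n.
Proof.
by move=> ww'; apply/eq_in_map => t; rewrite mem_iota => /andP[_]; exact: ww'.
Qed.

Let len_eq w w' n : (forall t, (t < n)%N -> w t = w' t) -> len w n = len w' n.
Proof.
move=> ww'; apply: eq_bigr => t _; rewrite (@eq_mkseq_lt w w') ?ww' //.
by move=> s st; rewrite ww' // (ltn_trans st).
Qed.

Let lo_eq w w' n : (forall t, (t < n)%N -> w t = w' t) -> lo w n = lo w' n.
Proof.
move=> ww'; apply: eq_bigr => t _; rewrite (@len_eq w w') ?ww' //.
  by rewrite (@eq_mkseq_lt w w') // => s st; rewrite ww' // (ltn_trans st).
by move=> s st; rewrite ww' // (ltn_trans st).
Qed.

Let cell_eq w w' n : (forall t, (t < n)%N -> w t = w' t) -> cell w n = cell w' n.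
Proof. by move=> ww'; rewrite /cell (lo_eq ww') (len_eq ww'). Qed.

Let cell_sub w n : cell w n.+1 `<=` cell w n.
Proof.
move=> x; rewrite !cellE hiS loS => /andP[h1 h2]; apply/andP; split.
  apply: le_trans h1; rewrite lerDl mulr_ge0 //.
  by apply: sumr_ge0 => i _; exact: dist_ge0.
apply: (lt_le_trans h2); rewrite lerD2l ler_piMr // -[leRHS](cum_card (mkseq w n)).
by rewrite cum_le // index_mem mem_enum.
Qed.

Let cell_le w m n : (m <= n)%N -> cell w n `<=` cell w m.
Proof.
elim: n => [|n IH]; first by rewrite leqn0 => /eqP ->.
rewrite leq_eqVlt => /predU1P[-> //|/IH]; apply: subset_trans; exact: cell_sub.
Qed.

Let cell_inj w w' n x : cell w n x -> cell w' n x ->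
  forall t, (t < n)%N -> w t = w' t.
Proof.
elim: n => [//|n IH] in w w' *.
have key v v' : (forall t, (t < n)%N -> v t = v' t) ->
    cell v n.+1 x -> cell v' n.+1 x -> (rk (v n) < rk (v' n))%N -> False.
  move=> vv'; rewrite !cellE !hiS !loS -(lo_eq vv') -(len_eq vv').
  rewrite -(eq_mkseq_lt vv') => /andP[_ xv] /andP[v'x _] vltv'.
  have := le_lt_trans v'x xv.
  by rewrite ltrD2l => /lt_geF /negP[]; rewrite ler_wpM2l // cum_le.
move=> cw cw'.
have ww' := IH _ _ (cell_sub cw) (cell_sub cw').
move=> t; rewrite ltnS leq_eqVlt => /predU1P[->|]; last exact: ww'.
have [/(key _ _ ww' cw cw')//| |] := ltngtP (rk (w n)) (rk (w' n)).
  by move=> /key -/(_ (fun t tn => esym (ww' t tn)) cw' cw).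
by apply: (index_inj a0 (s := enum A)); rewrite mem_enum.
Qed.

Let cell_ex x n : 0 <= x < 1 -> exists w, cell w n x.
Proof.
move=> x01; elim: n => [|n [w cw]].
  by exists (fun=> a0); rewrite cellE /lo /len !big_ord0 add0r.
have exm : exists m, x < lo w n + len w n * cum (mkseq w n) m.
  by exists (size (enum A)); rewrite cum_card mulr1; move: cw; rewrite cellE => /andP[].
case: (ex_minnP exm) => -[|m] xm mmin.
  move: cw xm; rewrite cellE /cum big_geq // mulr0 addr0 => /andP[lx _].
  by rewrite ltNge lx.
have msz : (m < size (enum A))%N.
  apply: mmin; rewrite cum_card mulr1; by move: cw; rewrite cellE => /andP[].
pose a := nth a0 (enum A) m.
have rka : rk a = m by rewrite /rk index_uniq ?enum_uniq.
pose w' t := if t == n then a else w t.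
have ww' t : (t < n)%N -> w t = w' t by rewrite /w'; case: ltngtP.
exists w'; rewrite cellE hiS loS -(lo_eq ww') -(len_eq ww') -(eq_mkseq_lt ww').
rewrite /w' eqxx rka xm andbT leNgt; apply/negP => /mmin.
by rewrite ltnn.
Qed.

Let path_ex x : exists w, 0 <= x < 1 -> forall n, cell w n x.
Proof.
have [x01|] := boolP (0 <= x < 1); last by exists (fun=> a0).
have /choice[W cW] : forall n, exists w, cell w n x by move=> n; exact: cell_ex.
exists (fun t => W t.+1 t) => _ n.
rewrite (@cell_eq _ (W n)) // => t tn.
by apply: (@cell_inj _ _ t.+1 x) => //; exact: (cell_le tn).
Qed.

Lemma sampling_ex : exists X : R -> nat -> A, forall w n,
  let C := [set x | forall t, (t < n)%N -> X x t = w t] in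
  measurable C /\
  lebesgue_measure (C `&` `[0, 1[) = (\prod_(t < n) q (mkseq w t) (w t))%:E.
Proof.
have /choice[X cX] := path_ex.
have XE w n x : 0 <= x < 1 ->
    (forall t, (t < n)%N -> X x t = w t) <-> cell w n x.
  move=> x01; split=> [Xw|]; last by apply: cell_inj; exact: cX.
  by rewrite -(@cell_eq (X x)) //; exact: cX.
pose c x : R := if 0 <= x < 1 then x else 0.
have c01 x : 0 <= c x < 1 by rewrite /c; case: ifPn => // _; rewrite lexx ltr01.
have cl w n x : cell w n x -> 0 <= x < 1.
  by move=> /(cell_le (leq0n n)); rewrite cellE /lo /len !big_ord0 add0r.
exists (X \o c) => w n C; split.
  have -> : C = cell w n `|` (~` `[0, 1[ `&` [set _ | cell w n 0]).
    apply/seteqP; split=> x; rewrite /C /= in_itv /= XE // /c.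
      by case: ifPn => [_|/negP]; [left|right].
    by case=> [/[dup] /cl ->//|[/negP/negbTE ->]].
  apply: measurableU; first by rewrite /cell; exact: measurable_itv.
  apply: measurableI; first exact: measurableC (measurable_itv _).
  have [c0|c0] := pselect (cell w n 0).
    by rewrite (_ : [set _ | _] = setT) //; apply/seteqP; split.
  by rewrite (_ : [set _ | _] = set0) //; apply/seteqP; split.
have -> : C `&` `[0, 1[ = cell w n.
  apply/seteqP; split=> x; rewrite /C /= in_itv /= XE // /c.
    by case=> cx x01; rewrite x01 in cx.
  by move=> /[dup] /cl ->.
rewrite lebesgue_measure_itv /= lte_fin -EFinB addrAC subrr add0r.
case: ifPn => //; rewrite ltrDl -leNgt => len0.
by congr EFin; apply/le_anti; rewrite len_ge0.
Qed.

End sampling.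

Section law.
Variables (R : realType) (K I J : pfinType).
Implicit Types (p : dist R K) (sigma : K -> seq (I * J) -> dist R I).
Implicit Type tau : seq (I * J) -> dist R J.

Fact dist_prod_subproof (a : dist R I) (b : dist R J) :
  let m : {ffun I * J -> R^o} := [ffun x => a x.1 * b x.2] in
  [forall x, 0 <= m x] && (\sum_x m x == 1).
Proof.
apply/andP; split.
  by apply/forallP => x; rewrite ffunE mulr_ge0 ?dist_ge0.
under eq_bigr do rewrite ffunE.
rewrite -(pair_bigA _ (fun i j => a i * b j)) /=.
by under eq_bigr do rewrite -mulr_sumr dist_sum1 mulr1; rewrite dist_sum1.
Qed.

Definition dist_prod a b : dist R (I * J)%type := Dist (dist_prod_subproof a b).

(* mkseq w t = [:: w 0; ...; w (t - 1)] is the history observed at stage t *)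
Definition is_law p sigma tau (P : set (play K I J) -> \bar R) :=
  forall k w n, P (cylinder k w n) =
    (p k * \prod_(t < n)
      (sigma k (mkseq w t) (w t).1 * tau (mkseq w t) (w t).2))%:E.

Lemma law_exists p sigma tau :
  exists P : probability (play K I J) R, is_law p sigma tau P.
Proof.
have /choice[X XP] k := @sampling_ex R (I * J)%type point (fun h => dist_prod (sigma k h) (tau h)).
pose phi k (x : R) : play K I J := (k, X k x).
have mphi k : measurable_fun setT (phi k).
  apply: (@measurability _ _ _ (play K I J) setT (phi k) (@cylinders K I J) erefl).
  move=> _ [_ [k' [w [n ->]]] <-]; rewrite setTI.
  have [mC _] := XP k w n.
  have [kk'|kk'] := pselect (k = k').
    rewrite (_ : _ @^-1` _ = [set x | forall t, (t < n)%N -> X k x t = w t]) //.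
    by apply/seteqP; split=> x //= => [[_]].
  rewrite (_ : _ @^-1` _ = set0) //.
  by apply/seteqP; split=> x //= => [[/kk']].
have m01 : measurable (`[0, 1[ : set R) by exact: measurable_itv.
pose mu := mrestr (@lebesgue_measure R) m01.
have /choice[m mE] k : exists m : {measure set (play K I J) -> \bar R},
    forall A, m A = mu (phi k @^-1` A).
  unshelve refine (ex_intro _ (pushforward (mrestr (@lebesgue_measure R) m01)
    (phi k) : {measure set (play K I J) -> \bar R}) _).
    exact: mphi.
  by [].
pose M (i : nat) : {measure set (play K I J) -> \bar R} :=
  mscale (NngNum (dist_ge0 p (nth point (enum K) i))) (m (nth point (enum K) i)).
pose P : {measure set (play K I J) -> \bar R} := msum M (size (enum K)).
have PE A : P A = (\sum_k (p k)%:E * mu (phi k @^-1` A))%E.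
  rewrite /P /= /msum -[RHS]big_enum (big_nth point) big_mkord.
  by apply: eq_bigr => i _; rewrite /M /= /mscale /= mE.
have P1 : P setT = 1%E.
  rewrite PE (eq_bigr (fun k => (p k)%:E)) => [|k _].
    by rewrite sumEFin dist_sum1.
  by rewrite /mu /mrestr preimage_setT setTI lebesgue_measure_itv /= lte_fin
    ltr01 sube0 mule1.
pose Q : probability (play K I J) R :=
  HB.pack (P : set (play K I J) -> \bar R) (Measure.class P)
    (Measure_isProbability.Build _ _ _ P P1).
exists Q => k w n.
rewrite [LHS]PE (bigD1 k) //= big1 ?adde0 => [|k' k'k].
  rewrite (_ : _ @^-1` _ = [set x | forall t, (t < n)%N -> X k x t = w t]).
    rewrite EFinM /mu /mrestr (XP k w n).2; congr (_ * _%:E)%E.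
    by apply: eq_bigr => t _; rewrite ffunE.
  by apply/seteqP; split=> x //= => [[_]].
rewrite (_ : _ @^-1` _ = set0); first by rewrite /mu /mrestr set0I measure0 mule0.
by apply/seteqP; split=> x //= => [[/eqP]]; rewrite (negbTE k'k).
Qed.

Definition law p sigma tau : probability (play K I J) R :=
  sval (cid (law_exists p sigma tau)).

Lemma lawP p sigma tau : is_law p sigma tau (law p sigma tau).
Proof. exact: svalP (cid (law_exists p sigma tau)). Qed.

Lemma law_unique p sigma tau (P : probability (play K I J) R) :
  is_law p sigma tau P ->
  forall A, measurable A -> P A = law p sigma tau A.
Proof.
move=> PP.
pose G : set (set (play K I J)) := [set C | @cylinders K I J C \/ C = set0].
have GP A : G A -> P A = law p sigma tau A.
  by case=> [[k [w [n ->]]]|->]; [rewrite PP lawP|rewrite !measure0].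
have Gm : G `<=` measurable.
  by move=> _ [[k [w [n ->]]]|->]; [exact: measurable_cylinder|].
have GI : setI_closed G.
  move=> C C' [[k [w [n ->]]]|->]; last by rewrite set0I; right.
  case=> [[k' [w' [n' ->]]]|->]; last by rewrite setI0; right.
  have [[[x1 x2] [/= [<- /= x2w] [<- /= x2w']]]|ne] := pselect
      (cylinder k w n `&` cylinder k' w' n' !=set0); last first.
    by right; apply/eqP/negPn/negP => /set0P.
  left; exists x1, x2, (maxn n n'); apply/seteqP; split=> -[y1 y2] /=.
    move=> [[/= -> /= yw] [/= _ /= yw']]; split=> // t; rewrite leq_max.
    by move=> /= /orP[tn|tn]; [rewrite yw ?x2w|rewrite yw' ?x2w'].
  move=> [/= -> /= y]; split; split=> //= t tn.
    by rewrite y ?leq_max ?tn // x2w.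
  by rewrite y ?leq_max ?tn ?orbT // x2w'.
pose g (i : nat) : set (play K I J) :=
  cylinder (nth point (enum K) i) (fun=> point) 0.
move=> A mA; apply: (g_sigma_algebra_measure_unique G Gm g) => //.
- by move=> i; left; do 3!eexists.
- apply/seteqP; split=> // -[k w] _; exists (index k (enum K)) => //.
  by split=> //=; rewrite nth_index // mem_enum.
- by move=> i; rewrite (le_lt_trans (probability_le1 _ _)) ?ltry //;
    exact: measurable_cylinder.
- by apply: sub_sigma_algebra2 mA => C GC; left.
Qed.

End law.

Section game.
Variables (R : realType) (K I J : pfinType).
Implicit Types (p : dist R K) (f : play K I J -> R).
Local Open Scope ereal_scope.

(* The histories, i.e. the union over t of (I * J)^t, are the elements of
   seq (I * J) *)
Definition strategyI := K -> seq (I * J) -> dist R I.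
Definition strategyII := seq (I * J) -> dist R J.
Definition nr_strategyI := seq (I * J) -> dist R I.

Definition payoff p f (sigma : strategyI) (tau : strategyII) : \bar R :=
  'E_(law p sigma tau)[f].

Definition nr_payoff p f (sigma : nr_strategyI) (tau : strategyII) : \bar R :=
  payoff p f (fun=> sigma) tau.

Definition maxmin p f : \bar R :=
  ereal_sup (range (fun sigma => ereal_inf (range (payoff p f sigma)))).

Definition nr_maxmin p f : \bar R :=
  ereal_sup (range (fun sigma => ereal_inf (range (nr_payoff p f sigma)))).

Definition nr_minmax p f : \bar R :=
  ereal_inf (range (fun tau => ereal_sup (range (nr_payoff p f ^~ tau)))).

Definition is_nr_value p f (v : R) :=
  nr_maxmin p f = v%:E /\ nr_minmax p f = v%:E.

(* For f bounded and Borel measurable the value exists by a theorem of Martin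
   (The determinacy of Blackwell games, 1998), so the default value of xget,
   there only to make nr_value total, is not used *)
Definition nr_value p f : R :=
  xget (fine (nr_maxmin p f)) [set v | is_nr_value p f v].

Lemma nr_valueP p f v : is_nr_value p f v -> nr_value p f = v.
Proof.
move=> v_val; rewrite /nr_value; case: xgetP => [w _ [wE _]|/(_ v)//].
by apply: EFin_inj; rewrite -wE; case: v_val.
Qed.

Definition tail_measurable f := forall k (w w' : nat -> I * J),
  finite_set [set t | w t <> w' t] -> f (k, w) = f (k, w').

End game.

(* Main.v *)
From HB Require Import structures.
Require Import Defs.
From mathcomp Require Import all_boot all_order all_algebra.
From mathcomp Require Import all_classical all_reals all_analysis.
From mathcomp Require Import interval_inference measurable_realfun.
From mathcomp Require Import ring lra.

(** Write [u q] for the non-revealing value at the prior [q], i.e. what Player I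
    can guarantee in the non-revealing game.

    Lower bound. Ignoring the state guarantees [u p], so the maxmin is at least
    [u]. Moreover the maxmin is concave in the prior: if [p] is an average of
    priors [q h], Player I can draw [h] with probabilities that depend on the
    state, so that the posterior given [h] is [q h], and then play well for
    [q h] (lemma [splitting]). A concave majorant of [u] is at least [cav u].

    Upper bound. Fix a strategy [sigma] of Player I, known to Player II. Under
    [sigma], and whatever Player II does, the posteriors on the state form a
    bounded martingale, and the expected squared norm of the posterior at stage
    [n] is nondecreasing in [n] and at most one. Player II picks a strategy and
    a stage [N] where this quantity is almost at its supremum over all strategies
    and stages. Then, however Player II continues, the posterior hardly moves
    after [N] (lemma [information_gain]). Let Player I replace [sigma] after
    stage [N] with its average with respect to the posterior, which ignores the
    state: the law of the histories is unchanged, the posterior is frozen, and so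
    the law of the whole play changes little in total variation. This is checked
    on the events determined by finitely many stages, and it passes to all
    events, hence to the expectation of [f] (lemmas [conceal_close] and
    [expectation_close_on_cylinders]).

    After a history [h] of length [N] the players thus face a non-revealing game
    whose prior is the posterior [q] given [h]. As [f] is tail measurable, the
    first [N] stages do not matter in it, and Player II has a reply that brings
    the payoff below [u q + e] (lemma [continuation_reply]). The posteriors
    average to [p], so by concavity the overall payoff is at most
    [cav u p] up to an arbitrarily small error (lemma [best_reply]). *)

Set Implicit Arguments.
Unset Strict Implicit.
Unset Printing Implicit Defensive.

Import Order.TTheory GRing.Theory Num.Theory.
Import numFieldNormedType.Exports.

Local Open Scope classical_set_scope.
Local Open Scope ring_scope.

(** * Events determined by finitely many stages *)

Section determined.
Variables (K I J : pfinType).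
Implicit Types (D : K -> seq (I * J) -> bool) (n : nat).

(** These events form the algebra generated by the cylinders. *)
Definition determined n D : set (play K I J) := [set x | D x.1 (mkseq x.2 n)].

Definition cyl (k : K) (h : seq (I * J)) : set (play K I J) :=
  cylinder k (nth point h) (size h).

Lemma cylE k h x : cyl k h x <-> x.1 = k /\ mkseq x.2 (size h) = h.
Proof.
split=> [[xk xh]|[xk xh]]; split=> //.
  apply: (@eq_from_nth _ point); rewrite size_mkseq // => t th.
  by rewrite nth_mkseq // xh.
by move=> t th; rewrite -[in RHS]xh nth_mkseq.
Qed.

Lemma measurable_cyl k h : measurable (cyl k h).
Proof. exact: measurable_cylinder. Qed.

Lemma take_mkseq T (w : nat -> T) m n : (m <= n)%N ->
  take m (mkseq w n) = mkseq w m.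
Proof. by move=> mn; rewrite /mkseq -map_take take_iota (minn_idPl mn). Qed.

Lemma determined_widen m n D : (m <= n)%N ->
  determined m D = determined n (fun k h => D k (take m h)).
Proof. by move=> mn; apply/seteqP; split=> x; rewrite /determined /= take_mkseq. Qed.

(** The fibres of [start n] are the cylinders of length [n], so an event
    determined at stage [n] is a disjoint union of them. *)
Definition start n (x : play K I J) : K * n.-tuple (I * J) :=
  (x.1, [tuple of mkseq x.2 n]).

Lemma startE n x (y : K * n.-tuple (I * J)) :
  start n x = y <-> cyl y.1 y.2 x.
Proof.
rewrite cylE size_tuple; case: y => k h; rewrite /start /=; split.
  by case=> -> <-.
by case=> -> xh; congr pair; apply/val_inj.
Qed.

Lemma determinedE n D : determined n D =
  \bigcup_(y : K * n.-tuple (I * J)) if D y.1 y.2 then cyl y.1 y.2 else set0.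
Proof.
apply/seteqP; split=> x.
  move=> Dx; exists (start n x) => //=; rewrite ifT //; exact: (startE x (start n x)).1.
case=> y _; case: ifPn => // Dy /cylE; rewrite size_tuple => -[xk xh].
by rewrite /determined /= xk xh.
Qed.

Lemma measurable_determined n D : measurable (determined n D).
Proof.
rewrite determinedE; apply: fin_bigcup_measurable => // y _.
by case: ifP => // _; exact: measurable_cyl.
Qed.

End determined.

Lemma measure_finU d (T : measurableType d) (R : realType)
    (mu : {measure set T -> \bar R}) (H : finType) (F : H -> set T) :
    (forall h, measurable (F h)) -> trivIset setT F ->
  (mu (\bigcup_h F h) = \sum_h mu (F h))%E.
Proof.
move=> mF tF; rewrite measure_fin_bigcup //; last exact: finite_finset.
rewrite [RHS]fsbig_seq ?index_enum_uniq //.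
by apply: eq_fsbigl; apply/seteqP; split=> h //= _; exact: mem_index_enum.
Qed.

Lemma measure_determined (R : realType) (K I J : pfinType)
    (P : {measure set (play K I J) -> \bar R}) n D :
  P (determined n D) =
  (\sum_(y : K * n.-tuple (I * J) | D y.1 y.2) P (cyl y.1 y.2))%E.
Proof.
rewrite determinedE measure_finU; last 2 first.
- by move=> y; case: ifP => // _; exact: measurable_cyl.
- by move=> y y' _ _ [x []]; do 2 case: ifP => // _; move=> /startE <- /startE <-.
by rewrite [RHS]big_mkcond; apply: eq_bigr => y _; case: ifP => // _; rewrite measure0.
Qed.

(** The events that are approximable in measure by determined ones contain the
    cylinders, and they form a sigma-algebra: a countable union is approximated
    by its finite subunions, because [mu] is finite. *)
Lemma determined_approx (R : realType) (K I J : pfinType)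
    (mu : {measure set (play K I J) -> \bar R}) (A : set (play K I J)) (e : R) :
    (mu setT < +oo)%E -> measurable A -> 0 < e ->
  exists n D, (mu (A `+` determined n D) <= e%:E)%E.
Proof.
move=> muoo mA; move: A mA e.
pose G : set (set (play K I J)) := [set A | measurable A /\
  forall e : R, 0 < e -> exists n D, (mu (A `+` determined n D) <= e%:E)%E].
suff GG : <<s @cylinders K I J >> `<=` G by move=> A /GG[].
have mdet n D : measurable (determined n D : set (play K I J)).
  exact: measurable_determined.
have mY (A B : set (play K I J)) : measurable A -> measurable B -> measurable (A `+` B).
  by move=> mA mB; apply: measurableU; exact: measurableD.
have det0 : determined 0 (fun=> xpred0) = set0 :> set (play K I J).
  by apply/seteqP; split.
have G0 : G set0.
  split=> // e e0; exists 0%N, (fun=> xpred0).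
  by rewrite det0 setYK measure0 lee_fin ltW.
have GU A B : G A -> G B -> G (A `|` B).
  move=> [mA GA] [mB GB]; split=> [|e e0]; first exact: measurableU.
  have [n [D AD]] := GA _ (divr_gt0 e0 (ltr0n _ 2)).
  have [m [E BE]] := GB _ (divr_gt0 e0 (ltr0n _ 2)).
  exists (maxn n m), (fun k h => D k (take n h) || E k (take m h)).
  have -> : determined (maxn n m) (fun k h => D k (take n h) || E k (take m h)) =
      determined n D `|` determined m E.
    rewrite (determined_widen _ (leq_maxl n m)) (determined_widen _ (leq_maxr n m)).
    by apply/seteqP; split=> x /orP.
  have -> : e%:E = ((e / 2)%:E + (e / 2)%:E)%E by rewrite -EFinD -splitr.
  apply: (le_trans _ (leeD AD BE)).
  apply: (le_trans _ (measureU2 _ _ _)); [|exact: mY|exact: mY].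
  apply: le_measure; rewrite ?inE; [| |move=> x /=; tauto].
    by apply: mY => //; exact: measurableU.
  by apply: measurableU; exact: mY.
apply: smallest_sub; last first.
  move=> _ [k [w [n ->]]]; split=> [|e e0]; first exact: measurable_cylinder.
  exists n, (fun k' h => (k' == k) && (h == mkseq w n)).
  rewrite (_ : determined _ _ = cylinder k w n).
    by rewrite setYK measure0 lee_fin ltW.
  apply/seteqP; split=> x /=.
    move=> /andP[/eqP xk /eqP xw]; split=> // t tn.
    by have /(congr1 (nth point ^~ t)) := xw; rewrite !nth_mkseq.
  move=> [xk xw]; apply/andP; split; apply/eqP => //.
  by apply/eq_in_map => t; rewrite mem_iota => /andP[_]; exact: xw.
split=> // [A [mA GA]|A' GA'].
  split=> [|e e0]; first exact: measurableD.
  have [n [D AD]] := GA _ e0; exists n, (fun k h => ~~ D k h).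
  have -> : determined n (fun k h => ~~ D k h) = ~` (determined n D : set (play K I J)).
    by apply/seteqP; split=> x /negP.
  suff -> : (setT `\` A) `+` ~` (determined n D) = A `+` determined n D by [].
  apply/seteqP; split=> x /=;
    by have [Ax|Ax] := pselect (A x); have [Dx|Dx] := pselect (determined n D x); tauto.
pose A : nat -> set (play K I J) := A'.
have GA k : G (A k) by exact: GA'.
rewrite -/A => {GA'}; have mA k : measurable (A k) by case: (GA k).
pose U m := \big[setU/set0]_(i < m) A i.
have GUm m : G (U m).
  by rewrite /U; elim: m => [|m IH]; rewrite ?big_ord0 // big_ord_recr; exact: GU.
have mU m : measurable (U m) by case: (GUm m).
have mcup : measurable (\bigcup_k A k) by exact: bigcupT_measurable.
split=> // e e0.
(* what the first m sets miss of the union decreases to the empty set *)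
have cvU : mu \o (fun m => \bigcup_k A k `\` U m) @ \oo --> mu (\bigcap_m (\bigcup_k A k `\` U m)).
  apply: nonincreasing_cvg_mu.
  - by apply: le_lt_trans muoo; apply: le_measure; rewrite ?inE //; exact: measurableD.
  - by move=> m; exact: measurableD.
  - by apply: bigcapT_measurable => m; exact: measurableD.
  - move=> m n mn; apply/subsetPset; apply: setDS.
    by apply: subset_bigsetU.
have cap0 : \bigcap_m (\bigcup_k A k `\` U m) = set0.
  apply/seteqP; split=> // x xA; have [[k _ Akx] _] := xA 0%N Logic.I.
  have [_] := xA k.+1 Logic.I; apply.
  by rewrite /U big_ord_recr; right.
move: cvU; rewrite cap0 measure0 => cvU.
have /cvU [m _ /(_ m (leqnn m)) /= mlt] : nbhs (0 : \bar R) [set x | (x < (e / 2)%:E)%E].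
  by apply: open_ereal_lt'; rewrite lte_fin divr_gt0.
have [_ /(_ _ (divr_gt0 e0 (ltr0n _ 2)))[n [D UD]]] := GUm m.
exists n, D.
have -> : e%:E = ((e / 2)%:E + (e / 2)%:E)%E by rewrite -EFinD -splitr.
apply: (le_trans _ (leeD (ltW mlt) UD)).
have mAU : measurable (\bigcup_k A k `\` U m) by exact: measurableD.
apply: (le_trans _ (measureU2 _ mAU (mY _ _ (mU m) (mdet n D)))).
apply: le_measure; rewrite ?inE; [exact: mY| |].
  by apply: measurableU => //; exact: mY.
have UA : U m `<=` \bigcup_k A k.
  by exact: bigsetU_bigcup.
by move=> x /=; have := UA x; have [|] := pselect (U m x); tauto.
Qed.

(** * Expectations under laws that are close on cylinders *)

Lemma probability_fineK d (T : measurableType d) (R : realType)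
    (P : probability T R) A : measurable A -> ((fine (P A))%:E = P A)%E.
Proof. by move=> mA; rewrite fineK // fin_num_measure. Qed.

(** The sum over the cylinders of length [n] bounds [P A - Q A] for the events
    [A] determined at stage [n]. A bound uniform in [n] passes to all events, as
    each of them is approximated, for [P] and [Q] simultaneously, by determined
    events. *)
Lemma close_on_cylinders (R : realType) (K I J : pfinType)
    (P Q : probability (play K I J) R) (N : nat) (C : R) :
    (forall n, (N <= n)%N -> \sum_(y : K * n.-tuple (I * J))
      `|fine (P (cyl y.1 y.2)) - fine (Q (cyl y.1 y.2))| <= C) ->
  forall A, measurable A -> (P A <= Q A + C%:E)%E.
Proof.
move=> PQ A mA.
have PQdet n D : (N <= n)%N ->
    fine (P (determined n D)) <= fine (Q (determined n D)) + C.
  move=> Nn; rewrite -lerBlDl.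
  have E (S : probability (play K I J) R) : fine (S (determined n D)) =
      \sum_(y : K * n.-tuple (I * J) | D y.1 y.2) fine (S (cyl y.1 y.2)).
    apply: EFin_inj; rewrite probability_fineK; last exact: measurable_determined.
    rewrite measure_determined -sumEFin; apply: eq_bigr => y _.
    by rewrite probability_fineK //; exact: measurable_cyl.
  rewrite !E -sumrB; apply: le_trans (PQ n Nn).
  rewrite big_mkcond; apply: ler_sum => y _.
  by case: ifP => _; [exact: ler_norm|exact: normr_ge0].
apply/lee_addgt0Pr => e e0.
pose mu : {measure set (play K I J) -> \bar R} := measure_add P Q.
have muE B : mu B = (P B + Q B)%E by exact: measure_addE.
have [] := @determined_approx R K I J mu A e.
- by rewrite muE !probability_setT -EFinD ltry.
- exact: mA.
- exact: e0.
move=> m [E].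
pose n := maxn m N; pose D k (h : seq (I * J)) := E k (take m h).
have -> : determined m E = determined n D by apply: determined_widen; exact: leq_maxl.
set B := determined n D.
have mB : measurable B by exact: measurable_determined.
have mAB : measurable (A `+` B) by apply: measurableU; exact: measurableD.
rewrite muE -(probability_fineK P mAB) -(probability_fineK Q mAB) -EFinD lee_fin => AB.
have H (S : probability (play K I J) R) (X Y : set (play K I J)) : measurable X -> measurable Y ->
    fine (S X) <= fine (S Y) + fine (S (X `+` Y)).
  move=> mX mY; have mXY : measurable (X `+` Y) by apply: measurableU; exact: measurableD.
  rewrite -lee_fin EFinD !probability_fineK //.
  apply: (le_trans _ (measureU2 _ mY mXY)); apply: le_measure; rewrite ?inE //.
    exact: measurableU.
  by move=> x /=; have [|] := pselect (Y x); tauto.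
have := H P A B mA mB; have := H Q B A mB mA; rewrite (setYC B A).
have := PQdet n D (leq_maxr _ _); rewrite -/B.
rewrite -(probability_fineK P mA) -(probability_fineK Q mA) -!EFinD lee_fin.
lra.
Qed.

Lemma bounded_Lfun d (T : measurableType d) (R : realType)
    (P : probability T R) (f : T -> R) (M : R) :
  measurable_fun setT f -> (forall x, `|f x| <= M) -> f \in Lfun P 1.
Proof.
move=> mf fM; apply/Lfun1_integrable.
apply: measurable_bounded_integrable => //.
  by rewrite (le_lt_trans (probability_le1 P measurableT)) ?ltry.
exists M; split; first exact: num_real.
by move=> y My x _ /=; apply: le_trans (fM x) _; exact: ltW.
Qed.

Lemma expectation_shift d (T : measurableType d) (R : realType)
    (P : probability T R) (f : T -> R) (M : R) :
  measurable_fun setT f -> (forall x, `|f x| <= M) ->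
  ('E_P[f] = 'E_P[f \+ cst M] - M%:E)%E.
Proof.
move=> mf fM.
rewrite expectationD; last 2 first.
- exact: bounded_Lfun fM.
- by apply: (@bounded_Lfun _ _ _ _ _ `|M|).
by rewrite expectation_cst addeK.
Qed.

(** Layer cake: the expectation of [f] is the integral of the probability of
    [f > r] over [r], and only the levels [r] in [0, M] contribute. *)
Lemma ge0_expectation_le_close d (T : measurableType d) (R : realType)
    (P Q : probability T R) (f : T -> R) (M C : R) : 0 <= C ->
    measurable_fun setT f -> (forall x, 0 <= f x <= M) ->
    (forall A, measurable A -> (P A <= Q A + C%:E)%E) ->
  ('E_P[f] <= 'E_Q[f] + (M * C)%:E)%E.
Proof.
move=> C0 mf f0M PQ.
have f0 x : 0 <= f x by have /andP[] := f0M x.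
pose X : {mfun T >-> R} := mfun_Sub (mem_set mf).
rewrite (_ : 'E_P[f] = 'E_P[X])%E // (_ : 'E_Q[f] = 'E_Q[X])%E //.
rewrite !ge0_expectation_ccdf //.
have M0 : 0 <= M by have /andP[fx] := f0M point; exact: le_trans.
pose D : set R := `[0, +oo[%classic.
have mD : measurable D by exact: measurable_itv.
have <- : (\int[lebesgue_measure]_(r in D) (C%:E * (\1_(`[0, M]%classic : set R) r)%:E) = (M * C)%:E)%E.
  rewrite ge0_integralZl //; last first.
    by apply/measurable_EFinP; exact: measurable_indic.
  rewrite integral_indic // setIidl; last first.
    by move=> x /=; rewrite /D /= !in_itv /= => /andP[->].
  rewrite /= lebesgue_measure_itv /= lte_fin.
  by case: ltgtP M0 => // [_|<-] _; rewrite -?EFinB ?subr0 -?EFinM ?mulr0 ?mul0r // mulrC.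
have mccdf (S : probability T R) : measurable_fun D (ccdf (P := S) X).
  by apply: measurable_funTS; exact: ccdf_measurable.
have mind : measurable_fun D (fun r => C%:E * (\1_(`[0, M]%classic : set R) r)%:E)%E.
  apply: emeasurable_funM; first exact: measurable_cst.
  by apply/measurable_EFinP; exact: measurable_indic.
have ind0 r : (0 <= C%:E * (\1_(`[0, M]%classic : set R) r)%:E)%E.
  by rewrite mule_ge0 ?lee_fin.
rewrite -ge0_integralD //; last exact: mccdf.
apply: ge0_le_integral => //; first exact: mccdf.
  by apply: emeasurable_funD => //; exact: mccdf.
move=> r; rewrite /D /= in_itv /= andbT => r0.
have [rM|rM] := leP r M.
  rewrite indicE mem_set /= ?in_itv /= ?r0 // mule1.
  by apply: PQ; rewrite -[X in measurable X]setTI; apply: measurable_funP.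
rewrite (_ : ccdf _ r = 0%E); first by rewrite adde_ge0 ?mule_ge0 ?lee_fin.
rewrite /ccdf /distribution /pushforward (_ : _ @^-1` _ = set0) ?measure0 //.
apply/seteqP; split=> // x /=; rewrite in_itv /= andbT => rx.
by have /andP[_] := f0M x; rewrite leNgt (lt_trans rM).
Qed.

Lemma expectation_le_close d (T : measurableType d) (R : realType)
    (P Q : probability T R) (f : T -> R) (M C : R) : 0 <= C ->
    measurable_fun setT f -> (forall x, `|f x| <= M) ->
    (forall A, measurable A -> (P A <= Q A + C%:E)%E) ->
  ('E_P[f] <= 'E_Q[f] + (2 * M * C)%:E)%E.
Proof.
move=> C0 mf fM PQ; rewrite !(expectation_shift _ mf fM) addeAC leeD2r //.
apply: ge0_expectation_le_close => //; first exact: measurable_funD.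
move=> x /=; have := fM x; rewrite ler_norml => /andP[]; lra.
Qed.

(** * Finite mixtures of probabilities *)

Section mixture.
Local Open Scope ereal_scope.
Context d (T : measurableType d) (R : realType) (H : finType).
Variables (m : H -> R) (P_ : H -> probability T R).
Hypothesis m0 : forall h, (0 <= m h)%R.

Let seq_mixture (s : seq H) : exists mu : {measure set T -> \bar R},
  (forall A, mu A = \sum_(h <- s) (m h)%:E * P_ h A) /\
  (forall f : T -> \bar R, measurable_fun setT f -> (forall x, 0 <= f x) ->
    \int[mu]_x f x = \sum_(h <- s) (m h)%:E * \int[P_ h]_x f x).
Proof.
elim: s => [|h s [mu [muE mu_int]]].
  exists mzero; split=> [A|f mf f0]; rewrite big_nil //.
  exact: integral_measure_zero.
pose mh : {measure set T -> \bar R} := mscale (NngNum (m0 h)) (P_ h).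
exists (measure_add mh mu); split=> [A|f mf f0]; rewrite big_cons.
  by rewrite -muE [LHS]measure_addE.
by rewrite ge0_integral_measure_add // mu_int // ge0_integral_mscale.
Qed.

Lemma mixture_ex : (\sum_h m h = 1)%R -> exists Q : probability T R,
  (forall A, Q A = \sum_h (m h)%:E * P_ h A) /\
  (forall (f : T -> R) (M : R), measurable_fun setT f ->
    (forall x, `|f x| <= M)%R -> 'E_Q[f] = \sum_h (m h)%:E * 'E_(P_ h)[f]).
Proof.
move=> m1; have [[mu cmu] [/= muE mu_int]] := seq_mixture (index_enum H).
have mu1 : mu setT = 1.
  rewrite muE (eq_bigr (fun h => (m h)%:E)); last first.
    by move=> h _; rewrite probability_setT mule1.
  by rewrite sumEFin m1.
pose Q : probability T R :=
  HB.pack mu cmu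
    (Measure_isProbability.Build _ _ _ (Measure.Pack cmu) mu1).
exists Q; split=> [//|f M mf fM].
(* adding M makes the integrand nonnegative, so that it can be integrated
   against a sum of measures *)
have fMint (P : probability T R) : 'E_P[f] = 'E_P[f \+ cst M] - M%:E.
  exact: expectation_shift.
have fin (P : probability T R) : 'E_P[f \+ cst M] \is a fin_num.
  apply: expectation_fin_num; apply: (@bounded_Lfun _ _ _ _ _ (M + `|M|)).
    exact: measurable_funD.
  by move=> x; apply: le_trans (ler_normD _ _) _; rewrite lerD2r.
have QE : 'E_Q[f \+ cst M] = \sum_h (m h)%:E * 'E_(P_ h)[f \+ cst M].
  rewrite unlock; apply: mu_int.
    by apply/measurable_EFinP; exact: measurable_funD.
  move=> x; rewrite lee_fin /=; have := fM x; rewrite ler_norml => /andP[].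
  by rewrite -lerBlDr sub0r.
rewrite fMint QE.
rewrite [RHS](eq_bigr (fun h => (m h * (fine 'E_(P_ h)[f \+ cst M] - M))%R%:E)); last first.
  by move=> h _; rewrite fMint EFinM EFinB fineK.
rewrite [X in X - _](eq_bigr (fun h => (m h * fine 'E_(P_ h)[f \+ cst M])%R%:E)); last first.
  by move=> h _; rewrite EFinM fineK.
rewrite !sumEFin -EFinB; congr EFin.
by under [RHS]eq_bigr do rewrite mulrBr; rewrite sumrB -mulr_suml m1 mul1r.
Qed.

End mixture.

(** * Likelihoods of histories *)

Section level_sums.
Variables (R : numDomainType) (A : finType).
Implicit Types (F : seq A -> R) (n : nat).

Lemma sum_tuple0 F : \sum_(h : 0.-tuple A) F h = F [::].
Proof.
rewrite (eq_bigr (fun=> F [::])) => [|h _]; last by rewrite (tuple0 h).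
by rewrite sumr_const card_tuple expn0.
Qed.

Lemma sum_tupleS n F :
  \sum_(h : n.+1.-tuple A) F h = \sum_(h : n.-tuple A) \sum_a F (rcons h a).
Proof.
rewrite pair_bigA /= (reindex (fun y : n.-tuple A * A => [tuple of rcons y.1 y.2])) //=.
exists (fun h => ([tuple of belast (thead h) (behead h)], last (thead h) (behead h))).
  move=> [h a] _; congr pair; first apply/val_inj => /=.
    by case: h => -[|b s] sz //=; rewrite /thead /= ?(tnth_nth a) /= ?belast_rcons.
  by case: h => -[|b s] sz //=; rewrite /thead /= ?(tnth_nth a) /= ?last_rcons.
move=> h _; apply/val_inj => /=; case/tupleP: h => a h /=.
by rewrite theadE -lastI.
Qed.

(** In a sum over histories of fixed length, summing out the last action pairs
    leaves the sum over shorter histories. This is how the martingale property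
    of the posteriors, weighted by the probabilities of the histories, is used. *)
Lemma sum_tuple_martingale F N n :
  (forall h, (N <= size h)%N -> \sum_a F (rcons h a) = F h) -> (N <= n)%N ->
  \sum_(h : n.-tuple A) F h = \sum_(h : N.-tuple A) F h.
Proof.
move=> FE; elim: n => [|n IH]; first by rewrite leqn0 => /eqP ->.
rewrite leq_eqVlt => /predU1P[-> //|]; rewrite ltnS => Nn.
rewrite sum_tupleS -IH //; apply: eq_bigr => h _.
by rewrite FE // size_tuple.
Qed.

End level_sums.

Section likelihood.
Variables (R : numDomainType) (A : pointedType).
Implicit Types (s : seq A -> A -> R) (h g : seq A).

Definition likelihood s h := \prod_(t < size h) s (take t h) (nth point h t).

Lemma likelihood_nil s : likelihood s [::] = 1.
Proof. by rewrite /likelihood big_ord0. Qed.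

Lemma likelihood_rcons s h a : likelihood s (rcons h a) = likelihood s h * s h a.
Proof.
rewrite /likelihood size_rcons big_ord_recr /= nth_rcons ltnn eqxx.
rewrite -cats1 take_size_cat //; congr (_ * _); apply: eq_bigr => t _.
by rewrite take_cat nth_cat ltn_ord.
Qed.

Lemma likelihood_cat s h g :
  likelihood s (h ++ g) = likelihood s h * likelihood (fun e => s (h ++ e)) g.
Proof.
elim/last_ind: g => [|g a IH]; first by rewrite cats0 likelihood_nil mulr1.
by rewrite -rcons_cat !likelihood_rcons IH mulrA.
Qed.

Lemma likelihood_ge0 s h : (forall e a, 0 <= s e a) -> 0 <= likelihood s h.
Proof. by move=> s0; apply: prodr_ge0. Qed.

Lemma eq_likelihood s s' h :
    (forall e a, (size e < size h)%N -> s e a = s' e a) ->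
  likelihood s h = likelihood s' h.
Proof.
move=> ss'; apply: eq_bigr => t _; apply: ss'.
by rewrite size_take ltn_ord.
Qed.

End likelihood.

Section game_likelihood.
Variables (R : realType) (K I J : pfinType).
Local Notation A := (I * J)%type.
Implicit Types (a : nr_strategyI R I J) (tau : strategyII R I J).

(** The probability of a history is the product of the prior and of the
    contributions [likI] and [likII] of the two players. *)
Definition likI a := likelihood (fun (h : seq A) x => a h x.1).
Definition likII tau := likelihood (fun (h : seq A) x => tau h x.2).

Lemma likI_ge0 a h : 0 <= likI a h.
Proof. by apply: likelihood_ge0 => *; exact: dist_ge0. Qed.

Lemma likII_ge0 tau h : 0 <= likII tau h.
Proof. by apply: likelihood_ge0 => *; exact: dist_ge0. Qed.

Lemma sum_dist_pair (p : dist R I) (q : dist R J) : \sum_(x : A) p x.1 * q x.2 = 1.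
Proof.
rewrite -(pair_bigA _ (fun i j => p i * q j)) /=.
by under eq_bigr do rewrite -mulr_sumr dist_sum1 mulr1; rewrite dist_sum1.
Qed.

Lemma sum_likI_likII_rcons a tau (h : seq A) :
  \sum_x likI a (rcons h x) * likII tau (rcons h x) = likI a h * likII tau h.
Proof.
under eq_bigr do rewrite /likI /likII !likelihood_rcons mulrACA.
by rewrite -mulr_sumr sum_dist_pair mulr1.
Qed.

Lemma sum_likI_likII a tau n :
  \sum_(h : n.-tuple A) likI a h * likII tau h = 1.
Proof.
rewrite (@sum_tuple_martingale _ _ (fun h => likI a h * likII tau h) 0) //.
  by rewrite (sum_tuple0 (fun h => likI a h * likII tau h)) /likI /likII !likelihood_nil mulr1.
by move=> h _; exact: sum_likI_likII_rcons.
Qed.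

Lemma law_cyl p (sigma : strategyI R K I J) tau k h :
  law p sigma tau (cyl k h) = (p k * likI (sigma k) h * likII tau h)%:E.
Proof.
rewrite lawP -mulrA -big_split; congr (_ * _)%:E.
apply: eq_bigr => t _; congr (sigma k _ _ * tau _ _).
all: apply: (@eq_from_nth _ point) => [|i]; rewrite size_mkseq ?size_takel ?(ltnW (ltn_ord t)) //.
all: by move=> it; rewrite nth_mkseq // nth_take.
Qed.

End game_likelihood.

Lemma expectation_close_on_cylinders (R : realType) (K I J : pfinType)
    (P Q : probability (play K I J) R) (f : play K I J -> R) (M C : R) N :
    measurable_fun setT f -> (forall x, `|f x| <= M) ->
    (forall n, (N <= n)%N -> \sum_k \sum_(h : n.-tuple (I * J))
      `|fine (P (cyl k h)) - fine (Q (cyl k h))| <= C) ->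
  ('E_P[f] <= 'E_Q[f] + (2 * M * C)%:E)%E.
Proof.
move=> mf fM PQ; apply: expectation_le_close => //.
  by apply: le_trans (PQ N (leqnn N)); do 2 apply: sumr_ge0 => ? _.
apply: (@close_on_cylinders _ _ _ _ _ _ N) => n Nn.
by rewrite -(pair_bigA _ (fun k (h : n.-tuple _) =>
  `|fine (P (cyl k h)) - fine (Q (cyl k h))|)) /=; exact: PQ.
Qed.

(** This is the form in which the uniqueness of a measure with given values on
    the cylinders is used; long cylinders suffice. *)
Lemma expectation_eq_on_cylinders (R : realType) (K I J : pfinType)
    (P Q : probability (play K I J) R) (f : play K I J -> R) (M : R) N :
    measurable_fun setT f -> (forall x, `|f x| <= M) ->
    (forall k h, (N <= size h)%N -> P (cyl k h) = Q (cyl k h)) ->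
  ('E_P[f] = 'E_Q[f])%E.
Proof.
move=> mf fM.
suff le (S S' : probability (play K I J) R) :
    (forall k h, (N <= size h)%N -> S (cyl k h) = S' (cyl k h)) ->
    ('E_S[f] <= 'E_S'[f])%E.
  by move=> PQ; apply/le_anti; rewrite !le // => k h Nh; rewrite PQ.
move=> SS'; rewrite -['E_S'[f]%E]adde0 (_ : 0%E = (2 * M * 0)%:E); last by rewrite mulr0.
apply: (@expectation_close_on_cylinders _ _ _ _ _ _ _ _ _ N) => // n Nn.
rewrite big1 // => k _; rewrite big1 // => h _.
by rewrite SS' ?size_tuple // subrr normr0.
Qed.

(** * Splitting and the lower bound *)

Section dirac_dist.
Variables (R : realType) (S : finType) (s0 : S).

Fact dirac_dist_subproof :
  let d : {ffun S -> R^o} := [ffun s => (s == s0)%:R] in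
  [forall s, 0 <= d s] && (\sum_s d s == 1).
Proof.
apply/andP; split; first by apply/forallP => s; rewrite ffunE.
under eq_bigr do rewrite ffunE.
by rewrite (bigD1 s0) //= eqxx big1 ?addr0 // => s /negbTE ->.
Qed.

Definition dirac_dist : dist R S := Dist dirac_dist_subproof.

Lemma dirac_distE s : dirac_dist s = (s == s0)%:R.
Proof. by rewrite ffunE. Qed.

End dirac_dist.

(** Normalizing by multiplication rather than division covers the weight zero,
    where any distribution will do: the posterior after a history of probability
    zero, or the conditional action of a player who cannot have reached it. *)
Lemma normalize_ex (R : realType) (S : pfinType) (x : S -> R) :
  (forall s, 0 <= x s) -> exists b : dist R S, forall s, (\sum_s x s) * b s = x s.
Proof.
move=> x0; have [X0|X0] := eqVneq (\sum_s x s) 0.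
  exists (dirac_dist R point) => s; rewrite X0 mul0r.
  by have /psumr_eq0P -> := X0.
pose d : {ffun S -> R^o} := [ffun s => x s / \sum_s x s].
have d1 : [forall s, 0 <= d s] && (\sum_s d s == 1).
  apply/andP; split.
    by apply/forallP => s; rewrite ffunE divr_ge0 // sumr_ge0.
  under eq_bigr do rewrite ffunE.
  by rewrite -mulr_suml divff.
by exists (Dist d1) => s; rewrite ffunE mulrC divfK.
Qed.

Lemma expectation_mixture_on_cylinders (R : realType) (K I J : pfinType)
    (H : finType) (m : H -> R) (P_ : H -> probability (play K I J) R)
    (P : probability (play K I J) R) (f : play K I J -> R) (M : R) N :
    (forall h, 0 <= m h) -> \sum_h m h = 1 ->
    measurable_fun setT f -> (forall x, `|f x| <= M) ->
    (forall k g, (N <= size g)%N ->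
      P (cyl k g) = \sum_h (m h)%:E * P_ h (cyl k g))%E ->
  ('E_P[f] = \sum_h (m h)%:E * 'E_(P_ h)[f])%E.
Proof.
move=> m0 m1 mf fM PE; have [Q [QE Qf]] := mixture_ex P_ m0 m1.
rewrite -(Qf f M) //; apply: (expectation_eq_on_cylinders (N := N)) => // k g Ng.
by rewrite PE // QE.
Qed.

Section bounded_game.
Variables (R : realType) (K I J : pfinType) (f : play K I J -> R) (M : R).
Hypotheses (mf : measurable_fun setT f) (fM : forall x, `|f x| <= M).
Implicit Types (p q : dist R K) (sigma : strategyI R K I J).
Implicit Types (tau : strategyII R I J).

Lemma payoff_fin p sigma tau : payoff p f sigma tau \is a fin_num.
Proof. by apply: expectation_fin_num; exact: bounded_Lfun fM. Qed.

Lemma payoff_bound p sigma tau :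
  ((- M)%:E <= payoff p f sigma tau <= M%:E)%E.
Proof.
have bnd (P : probability (play K I J) R) (g h : play K I J -> R) :
    measurable_fun setT g -> measurable_fun setT h -> (forall x, `|g x| <= `|M|) ->
    (forall x, `|h x| <= `|M|) -> (forall x, g x <= h x) -> ('E_P[g] <= 'E_P[h])%E.
  move=> mg mh gM hM gh; rewrite unlock; apply: le_integral => //.
  - by apply/Lfun1_integrable; exact: bounded_Lfun gM.
  - by apply/Lfun1_integrable; exact: bounded_Lfun hM.
  - by move=> x _; rewrite lee_fin.
have fM' x : `|f x| <= `|M| by apply: le_trans (fM x) (ler_norm _).
rewrite /payoff -[X in (X <= _ <= _)%E](expectation_cst (law p sigma tau)).
rewrite -[X in (_ <= _ <= X)%E](expectation_cst (law p sigma tau)).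
apply/andP; split; apply: bnd => //= x; rewrite ?normrN //;
  by have := fM x; rewrite ler_norml => /andP[].
Qed.

(** Splitting: with prior [p], Player I can draw [h] with a probability that
    depends on the state, in such a way that [h] has law [m] and that the
    posterior given [h] is [q h], and then play [sigma h]. The behavior strategy
    equivalent to this lottery mixes the [sigma h] with weights proportional to
    the probability of [h] given the state and the past actions. *)
Lemma splitting (H : finType) (m : H -> R) (q : H -> dist R K) p
    (sigma : H -> strategyI R K I J) :
    (forall h, 0 <= m h) -> (forall k, p k = \sum_h m h * q h k) ->
  exists sigma', forall tau,
    (payoff p f sigma' tau = \sum_h (m h)%:E * payoff (q h) f (sigma h) tau)%E.
Proof.
move=> m0 pE.
have m1 : \sum_h m h = 1.
  rewrite -(dist_sum1 p) (eq_bigr _ (fun k _ => pE k)) exchange_big /=.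
  by apply: eq_bigr => h _; rewrite -mulr_sumr dist_sum1 mulr1.
(* w k g is the probability of the state k, times the probability that
   Player I's actions along g are drawn when Player II's actions are those of g *)
pose w k g := \sum_h m h * q h k * likI (sigma h k) g.
have /choice[s sE] (k : K) : exists s : seq (I * J) -> dist R I, forall g i,
    w k g * s g i = \sum_h m h * q h k * likI (sigma h k) g * sigma h k g i.
  have /choice[s sE] (g : seq (I * J)) : exists b : dist R I, forall i,
      w k g * b i = \sum_h m h * q h k * likI (sigma h k) g * sigma h k g i.
    have [|b bE] := @normalize_ex R I (fun i =>
      \sum_h m h * q h k * likI (sigma h k) g * sigma h k g i).
      move=> i; apply: sumr_ge0 => h _.
      by rewrite !mulr_ge0 ?dist_ge0 ?likI_ge0.
    exists b => i; rewrite -bE; congr (_ * _); rewrite exchange_big /=.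
    by apply: eq_bigr => h _; rewrite -mulr_sumr dist_sum1 mulr1.
  by exists s.
have wE k g : p k * likI (s k) g = w k g.
  elim/last_ind: g => [|g a IH].
    rewrite /likI likelihood_nil mulr1 pE; apply: eq_bigr => h _.
    by rewrite /likI likelihood_nil mulr1.
  rewrite /likI likelihood_rcons mulrA IH sE; apply: eq_bigr => h _.
  by rewrite /likI likelihood_rcons mulrA.
exists s => tau; apply: (expectation_mixture_on_cylinders (N := 0) m0 m1 mf fM).
move=> k g _; rewrite law_cyl wE /w mulr_suml -sumEFin; apply: eq_bigr => h _.
by rewrite law_cyl -EFinM !mulrA.
Qed.

End bounded_game.

Section bounded_values.
Variables (R : realType) (K I J : pfinType) (f : play K I J -> R) (M : R).
Hypotheses (mf : measurable_fun setT f) (fM : forall x, `|f x| <= M).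
Implicit Types (p q : dist R K) (sigma : strategyI R K I J).
Implicit Types (tau : strategyII R I J).
Local Open Scope ereal_scope.

Lemma inf_payoff_bound p sigma :
  (- M)%:E <= ereal_inf (range (payoff p f sigma)) <= M%:E.
Proof.
apply/andP; split.
  apply: le_ereal_inf_tmp => _ [tau _ <-].
  by have /andP[] := payoff_bound mf fM p sigma tau.
pose tau : strategyII R I J := fun=> dirac_dist R point.
apply: le_trans (ereal_inf_lbound (ex_intro2 _ _ tau Logic.I erefl)) _.
by have /andP[] := payoff_bound mf fM p sigma tau.
Qed.

Lemma sup_inf_payoff_fin (S : Type) (s0 : S) (sg : S -> strategyI R K I J) p :
  ereal_sup (range (fun s => ereal_inf (range (payoff p f (sg s))))) \is a fin_num.
Proof.
rewrite fin_numElt; apply/andP; split.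
  apply: lt_le_trans (ereal_sup_ubound (ex_intro2 _ _ s0 Logic.I erefl)).
  by have /andP[+ _] := inf_payoff_bound p (sg s0); apply: lt_le_trans; rewrite ltNyr.
apply: (@le_lt_trans _ _ M%:E); last exact: ltry.
by apply: ge_ereal_sup => _ [s _ <-]; have /andP[] := inf_payoff_bound p (sg s).
Qed.

Let s0 : nr_strategyI R I J :=
  fun=> dirac_dist R point.

Lemma maxmin_fin p : maxmin p f \is a fin_num.
Proof. exact: (sup_inf_payoff_fin (fun=> s0) id). Qed.

Lemma nr_maxmin_fin p : nr_maxmin p f \is a fin_num.
Proof. exact: (sup_inf_payoff_fin s0 (fun s => fun=> s)). Qed.

(** Whenever the non-revealing game has a value, it is its maxmin; the default
    value of [nr_value] is the maxmin too. *)
Lemma nr_valueE p : (nr_value p f)%:E = nr_maxmin p f.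
Proof.
rewrite -[RHS](fineK (nr_maxmin_fin p)); congr EFin; rewrite /nr_value.
by case: xgetP => // v _ [-> _].
Qed.

Lemma nr_value_le p : (nr_value p f <= M)%R.
Proof.
rewrite -lee_fin nr_valueE; apply: ge_ereal_sup => _ [s _ <-].
by have /andP[] := inf_payoff_bound p (fun=> s).
Qed.

Lemma nr_maxmin_le_maxmin p : nr_maxmin p f <= maxmin p f.
Proof. by apply: ereal_sup_le => _ [s _ <-]; exists (fun=> s). Qed.

(** Player I first splits the prior into the two given ones, and then plays
    almost optimally for the one that has been drawn. *)
Lemma maxmin_concave : concave (fun p => fine (maxmin p f)).
Proof.
move=> t p1 p2; rewrite convRE -lee_fin fineK ?maxmin_fin //.
set p := conv t p1 p2.
have pE k : p k = (t%:num * p1 k + (1 - t%:num) * p2 k)%R by rewrite !ffunE.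
have opt (q : dist R K) (e : R) : (0 < e)%R -> exists sigma, forall tau,
    ((fine (maxmin q f) - e)%:E <= payoff q f sigma tau).
  move=> e0; have : (fine (maxmin q f) - e)%:E < maxmin q f.
    by rewrite -[ltRHS](fineK (maxmin_fin q)) lte_fin ltrBlDr ltrDl.
  move=> /ereal_sup_gt[_ [sigma _ <-] lt_inf]; exists sigma => tau.
  by apply: le_trans (ltW lt_inf) _; apply: ereal_inf_lbound; exists tau.
apply/lee_subgt0Pr => e e0.
have [s1 s1P] := opt p1 e e0; have [s2 s2P] := opt p2 e e0.
pose m (b : bool) : R := if b then t%:num else (1 - t%:num)%R.
have m0 b : (0 <= m b)%R by case: b => //=; rewrite subr_ge0.
have [|s sP] := splitting mf fM (m := m) (q := fun b : bool => if b then p1 else p2)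
  (p := p) (fun b : bool => if b then s1 else s2) m0.
  by move=> k; rewrite big_bool /= pE.
apply: (@le_trans _ _ (ereal_inf (range (payoff p f s)))); last first.
  by apply: ereal_sup_ubound; exists s.
apply: le_ereal_inf_tmp => _ [tau _ <-]; rewrite sP big_bool /=.
have -> : (t%:num * fine (maxmin p1 f) + (1 - t%:num) * fine (maxmin p2 f))%:E - e%:E =
    t%:num%:E * (fine (maxmin p1 f) - e)%:E + (1 - t%:num)%:E * (fine (maxmin p2 f) - e)%:E.
  by rewrite -EFinB -!EFinM -EFinD; congr EFin; ring.
apply: leeD; apply: lee_wpmul2l; rewrite ?lee_fin ?subr_ge0 //.
Qed.

(** The maxmin is a concave function that majorizes the non-revealing value,
    because Player I may ignore the state. *)
Lemma cav_le_maxmin p :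
  (cav (fun q => nr_value q f) p)%:E <= maxmin p f.
Proof.
have [_ _ least] : _ := cav_least (ex_intro _ M nr_value_le).
rewrite -[leRHS](fineK (maxmin_fin p)) lee_fin.
apply: (least (fun p => fine (maxmin p f))) => [|q]; first exact: maxmin_concave.
by rewrite -lee_fin fineK ?maxmin_fin // nr_valueE nr_maxmin_le_maxmin.
Qed.

End bounded_values.

(** * Jensen's inequality on the simplex *)

(** Jensen's inequality for weights [m] that need not sum to one, a form that
    is stable under removing one of the weights. *)
Lemma concave_jensen (R : realType) (K : pfinType) (g : dist R K -> R)
    (H : Type) (s : seq H) (m : H -> R) (q : H -> dist R K) (p : dist R K) :
    concave g -> (forall h, 0 <= m h) ->
    (forall k, (\sum_(h <- s) m h) * p k = \sum_(h <- s) m h * q h k) ->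
  \sum_(h <- s) m h * g (q h) <= (\sum_(h <- s) m h) * g p.
Proof.
move=> cg m0; elim: s p => [|h s IH] p; first by rewrite !big_nil mul0r.
rewrite !big_cons => pE.
have M0 : 0 <= \sum_(h <- s) m h by exact: sumr_ge0.
have [|p' p'E] := @normalize_ex R K (fun k => \sum_(h <- s) m h * q h k).
  by move=> k; apply: sumr_ge0 => h' _; rewrite mulr_ge0 ?dist_ge0.
have sumE : \sum_k \sum_(h <- s) m h * q h k = \sum_(h <- s) m h.
  by rewrite exchange_big /=; apply: eq_bigr => h' _; rewrite -mulr_sumr dist_sum1 mulr1.
have {}p'E k : (\sum_(h <- s) m h) * p' k = \sum_(h <- s) m h * q h k.
  by rewrite -sumE p'E.
apply: (@le_trans _ _ (m h * g (q h) + (\sum_(h <- s) m h) * g p')).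
  by rewrite lerD2l; exact: IH.
move: pE M0 p'E {IH sumE}; set M := \sum_(h <- s) m h => pE M0 p'E.
have := addr_ge0 (m0 h) M0; rewrite le_eqVlt => /predU1P[/esym mM0|mM_gt0].
  have /eqP := mM0; rewrite paddr_eq0 // => /andP[/eqP -> /eqP ->].
  by rewrite !mul0r addr0 mul0r.
have t0 : 0 <= m h / (m h + M) by rewrite divr_ge0 // ltW.
have t1 : m h / (m h + M) <= 1 by rewrite ler_pdivrMr // mul1r lerDl.
have -> : p = conv (Itv01 t0 t1) (q h) p'.
  apply/val_inj/ffunP => k; rewrite !ffunE /=.
  apply: (mulfI (lt0r_neq0 mM_gt0)).
  transitivity (m h * q h k + M * p' k); first by rewrite pE big_cons -p'E.
  by rewrite /GRing.scale /unstable.onem /=; field; exact: lt0r_neq0.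
have := cg (Itv01 t0 t1) (q h) p'; rewrite convRE /= => /(ler_wpM2l (ltW mM_gt0)).
apply: le_trans; rewrite le_eqVlt; apply/orP; left; apply/eqP.
by rewrite /unstable.onem; field; exact: lt0r_neq0.
Qed.

(** * Continuation games *)

Section continuation.
Variables (R : realType) (K I J : pfinType).
Local Notation A := (I * J)%type.
Implicit Types (a : nr_strategyI R I J) (tau : strategyII R I J).

(** The strategy that plays the fixed action [point] during the first [N] stages
    and then behaves as [s] would, had the first [N] stages been [h]. When both
    players do so, the game is the continuation of the original one after [h],
    with the stages kept at their dates: tail measurability makes [f] insensitive
    to a change of the first [N] stages, but not to a shift of time. *)
Definition continue (S : pfinType) N (h : seq A) (s : seq A -> dist R S) :
    seq A -> dist R S :=
  fun e => if (size e < N)%N then dirac_dist R point else s (h ++ drop N e).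

Lemma likelihood_dirac (S : pfinType) (x : A -> S) N (h : seq A)
    (s : seq A -> dist R S) (e : seq A) : (size e <= N)%N ->
  likelihood (fun e y => continue N h s e (x y)) e = (all (fun y => x y == point) e)%:R.
Proof.
elim/last_ind: e => [|e y IH]; first by rewrite likelihood_nil.
rewrite size_rcons => eN; rewrite likelihood_rcons IH 1?ltnW // /continue eN.
by rewrite dirac_distE -natrM mulnb all_rcons andbC.
Qed.

Lemma likelihood_continue (S : pfinType) (x : A -> S) N (h : seq A)
    (s : seq A -> dist R S) (e : seq A) : (N <= size e)%N ->
  likelihood (fun e y => continue N h s e (x y)) e =
  (all (fun y => x y == point) (take N e))%:R *
  likelihood (fun e y => s (h ++ e) (x y)) (drop N e).
Proof.
move=> Ne; rewrite -{1}(cat_take_drop N e) likelihood_cat.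
have sN : size (take N e) = N by rewrite size_takel.
rewrite likelihood_dirac ?sN //; congr (_ * _); apply: eq_likelihood => e' y _.
by rewrite /continue size_cat sN ltnNge leq_addr /= (drop_size_cat _ sN).
Qed.

Lemma likI_likII_continue a tau N h e : (N <= size e)%N ->
  likI (continue N h a) e * likII (continue N h tau) e =
  (take N e == nseq N point)%:R *
  (likI (fun e => a (h ++ e)) (drop N e) * likII (fun e => tau (h ++ e)) (drop N e)).
Proof.
move=> Ne; rewrite /likI /likII !likelihood_continue // mulrACA; congr (_ * _).
rewrite -natrM mulnb -all_predI; congr (_%:R).
have -> : (take N e == nseq N point) = all (pred1 point) (take N e).
  apply/eqP/all_pred1P; by rewrite size_takel.
by congr (nat_of_bool _); apply: eq_all => -[i j] /=.
Qed.

End continuation.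

Section reset.
Variables (K I J : pfinType) (N : nat).
Local Notation A := (I * J)%type.

Definition reset (x : play K I J) : play K I J :=
  (x.1, fun t => if (t < N)%N then point else x.2 t).

Lemma mkseq_reset x n : (N <= n)%N ->
  mkseq (reset x).2 n = nseq N point ++ drop N (mkseq x.2 n).
Proof.
move=> Nn; apply: (@eq_from_nth _ point) => [|t].
  by rewrite size_cat size_nseq size_drop !size_mkseq subnKC.
rewrite size_mkseq => tn; rewrite nth_cat size_nseq nth_mkseq //=.
case: ltnP => tN; first by rewrite nth_nseq tN.
by rewrite nth_drop subnKC // nth_mkseq.
Qed.

Lemma measurable_reset : measurable_fun setT reset.
Proof.
apply: (@measurability _ _ _ (play K I J) setT reset (@cylinders K I J) erefl).
move=> _ [_ [k [w [n ->]]] <-]; rewrite setTI.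
rewrite (_ : _ @^-1` _ = determined n (fun k' g => (k' == k) &&
  (mkseq (fun t => if (t < N)%N then point else nth point g t) n == mkseq w n))).
  exact: measurable_determined.
apply/seteqP; split=> x; rewrite /determined /=.
  move=> [/= -> xw]; rewrite eqxx /=; apply/eqP/eq_in_map => t.
  rewrite mem_iota /= add0n => tn; rewrite -xw // nth_mkseq //.
move=> /andP[/eqP xk /eqP xw]; split=> // t tn.
by have /(congr1 (nth point ^~ t)) := xw; rewrite !nth_mkseq.
Qed.

Lemma reset_cyl k (g : seq A) : (N <= size g)%N ->
  reset @^-1` cyl k g = \bigcup_(h : N.-tuple A)
    if take N g == nseq N point then cyl k (h ++ drop N g) else set0.
Proof.
move=> Ng; apply/seteqP; split=> x; rewrite /preimage /=.
  move=> /cylE[xk]; rewrite mkseq_reset // => xg.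
  have gN : take N g = nseq N point by rewrite -{1}xg take_size_cat ?size_nseq.
  exists [tuple of mkseq x.2 N] => //; rewrite gN eqxx; apply/cylE.
  split=> //=; rewrite size_cat size_mkseq size_drop subnKC //.
  have -> : drop N g = drop N (mkseq x.2 (size g)).
    by rewrite -{1}xg drop_size_cat ?size_nseq.
  by rewrite -(take_mkseq _ Ng) cat_take_drop.
case=> h _; case: ifP => // /eqP gN /cylE[xk].
rewrite size_cat size_tuple size_drop subnKC // => xh; apply/cylE; split=> //.
by rewrite mkseq_reset // xh drop_size_cat ?size_tuple // -gN cat_take_drop.
Qed.

End reset.

Section continuation_payoff.
Variables (R : realType) (K I J : pfinType) (f : play K I J -> R) (M : R).
Hypotheses (mf : measurable_fun setT f) (fM : forall x, `|f x| <= M).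
Hypothesis tail_f : tail_measurable f.
Local Notation A := (I * J)%type.
Implicit Types (p : dist R K) (sigma : strategyI R K I J) (tau : strategyII R I J).

Lemma tail_reset N x : f (reset N x) = f x.
Proof.
case: x => k w; apply: tail_f.
apply: (sub_finite_set _ (finite_II N)) => t /=.
by case: ifP.
Qed.

(** The payoff is the average of the payoffs in the continuation games after the
    histories [h] of length [N], where [m h] is the probability of [h] and [q h]
    is the posterior. Indeed [reset] preserves the payoff, and the image by
    [reset] of the law of the play is the mixture of the laws of the continuation
    games. *)
Lemma continuation_payoff N p sigma tau (m : N.-tuple A -> R) (q : N.-tuple A -> dist R K) :
    (forall h, 0 <= m h) ->
    (forall k (h : N.-tuple A), m h * q h k = p k * likI (sigma k) h * likII tau h) ->
  (payoff p f sigma tau = \sum_h (m h)%:E *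
    payoff (q h) f (fun k => continue N h (sigma k)) (continue N h tau))%E.
Proof.
move=> m0 mq.
have m1 : \sum_h m h = 1.
  rewrite (eq_bigr (fun h : N.-tuple A => \sum_k p k * (likI (sigma k) h * likII tau h))).
    rewrite exchange_big /= -(dist_sum1 p); apply: eq_bigr => k _.
    by rewrite -mulr_sumr sum_likI_likII mulr1.
  move=> h _; under eq_bigr do rewrite mulrA -mq.
  by rewrite -mulr_sumr dist_sum1 mulr1.
pose X : {mfun play K I J >-> play K I J} := mfun_Sub (mem_set (@measurable_reset K I J N)).
pose P := law p sigma tau.
have -> : payoff p f sigma tau = ('E_(distribution P X)[f])%E.
  rewrite /payoff unlock integral_distribution.
  - by apply: eq_integral => x _ /=; rewrite tail_reset.
  - exact/measurable_EFinP.
  - rewrite (_ : _ \o X = EFin \o f).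
      by apply/Lfun1_integrable; exact: bounded_Lfun fM.
    by apply/funext => x /=; rewrite tail_reset.
apply: (expectation_mixture_on_cylinders (N := N) m0 m1 mf fM) => k g Ng.
transitivity (P (reset N @^-1` cyl k g)); first by [].
rewrite reset_cyl // measure_finU; last 2 first.
- by move=> h; case: ifP => // _; exact: measurable_cyl.
- move=> h h' _ _ [x []]; case: ifP => // _ /cylE[_ xh] /cylE[_].
  rewrite !size_cat !size_tuple in xh * => xh'; apply/val_inj.
  have : h ++ drop N g = h' ++ drop N g by rewrite -xh -xh'.
  by move=> /eqP; rewrite eqseq_cat ?size_tuple // => /andP[/eqP].
apply: eq_bigr => h _; rewrite law_cyl -mulrA likI_likII_continue // -EFinM.
case: ifP => _; last by rewrite measure0 mul0r !mulr0.
apply: etrans (law_cyl _ _ _ _ _) _.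
by rewrite mul1r mulrA mq /likI /likII !likelihood_cat; congr EFin; ring.
Qed.

End continuation_payoff.

(** * Posteriors and non-revealing averages *)

Section posterior.
Variables (R : realType) (K I J : pfinType) (p : dist R K) (sigma : strategyI R K I J).
Local Notation A := (I * J)%type.
Implicit Types (tau : strategyII R I J) (h : seq A).

(** [joint k h] is the contribution of Nature and of Player I to the probability
    of [(k, h)]; the remaining factor [likII] is independent of the state. For
    this reason the posterior given [h] depends on [sigma] alone. *)
Definition joint k h := p k * likI (sigma k) h.

Definition marginal h := \sum_k joint k h.

Lemma joint_ge0 k h : 0 <= joint k h.
Proof. by rewrite mulr_ge0 ?dist_ge0 ?likI_ge0. Qed.

Lemma marginal_ge0 h : 0 <= marginal h.
Proof. by apply: sumr_ge0 => k _; exact: joint_ge0. Qed.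

Lemma joint_rcons k h x : joint k (rcons h x) = joint k h * sigma k h x.1.
Proof. by rewrite /joint /likI likelihood_rcons mulrA. Qed.

Lemma sum_joint_likII_rcons k tau h :
  \sum_x joint k (rcons h x) * likII tau (rcons h x) = joint k h * likII tau h.
Proof.
under eq_bigr do rewrite /joint -mulrA.
by rewrite -mulr_sumr sum_likI_likII_rcons mulrA.
Qed.

Lemma sum_marginal_likII_rcons tau h :
  \sum_x marginal (rcons h x) * likII tau (rcons h x) = marginal h * likII tau h.
Proof.
under eq_bigr do rewrite mulr_suml.
rewrite exchange_big mulr_suml; apply: eq_bigr => k _.
exact: sum_joint_likII_rcons.
Qed.

Lemma sum_joint_likII k tau n :
  \sum_(h : n.-tuple A) joint k h * likII tau h = p k.
Proof.
under eq_bigr do rewrite /joint -mulrA.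
by rewrite -mulr_sumr sum_likI_likII mulr1.
Qed.

Lemma sum_marginal_likII tau n :
  \sum_(h : n.-tuple A) marginal h * likII tau h = 1.
Proof.
under eq_bigr do rewrite mulr_suml.
rewrite exchange_big -(dist_sum1 p); apply: eq_bigr => k _.
exact: sum_joint_likII.
Qed.

Lemma posterior_ex : exists post : seq A -> dist R K,
  forall h k, marginal h * post h k = joint k h.
Proof.
have /choice[post postE] : forall h, exists b : dist R K,
    forall k, marginal h * b k = joint k h.
  by move=> h; apply: normalize_ex => k; exact: joint_ge0.
by exists post.
Qed.

(** From Player II's viewpoint, Player I's action after [h] is drawn from the
    average, weighted by the posterior, of the actions that [sigma] prescribes in
    the different states. *)
Lemma average_strategy_ex : exists sbar : nr_strategyI R I J,
  forall h i, marginal h * sbar h i = \sum_k joint k h * sigma k h i.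
Proof.
have /choice[s sE] : forall h, exists b : dist R I,
    forall i, marginal h * b i = \sum_k joint k h * sigma k h i.
  move=> h; have [|b bE] := @normalize_ex R I (fun i => \sum_k joint k h * sigma k h i).
    by move=> i; apply: sumr_ge0 => k _; rewrite mulr_ge0 ?joint_ge0 ?dist_ge0.
  exists b => i; rewrite -bE; congr (_ * _); rewrite exchange_big /=.
  by apply: eq_bigr => k _; rewrite -mulr_sumr dist_sum1 mulr1.
by exists s.
Qed.

Variables (post : seq A -> dist R K) (sbar : nr_strategyI R I J).
Hypothesis postE : forall h k, marginal h * post h k = joint k h.
Hypothesis sbarE : forall h i, marginal h * sbar h i = \sum_k joint k h * sigma k h i.

(** Player I uses [sigma] during [N] stages, and from then on the average
    strategy, which reveals nothing more about the state. *)
Definition conceal N : strategyI R K I J :=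
  fun k h => if (size h < N)%N then sigma k h else sbar h.

Lemma marginal_rcons h x : marginal (rcons h x) = marginal h * sbar h x.1.
Proof. by rewrite sbarE; apply: eq_bigr => k _; exact: joint_rcons. Qed.

(** Under [conceal N] the histories have the same law as under [sigma], but the
    posterior stays at its value at stage [N]. *)
Lemma joint_conceal N k h : (N <= size h)%N ->
  p k * likI (conceal N k) h = marginal h * post (take N h) k.
Proof.
have base h' : size h' = N -> p k * likI (conceal N k) h' = marginal h' * post (take N h') k.
  move=> hN; rewrite -{2}hN take_size postE /joint; congr (_ * _).
  by apply: eq_likelihood => e a; rewrite hN /conceal => ->.
elim/last_ind: h => [|h x IH]; first by rewrite leqn0 => /eqP N0; apply: base.
rewrite leq_eqVlt => /predU1P[/esym/base //|]; rewrite size_rcons ltnS => Nh.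
rewrite /likI likelihood_rcons mulrA IH // /conceal ltnNge Nh /=.
by rewrite marginal_rcons -cats1 takel_cat // mulrAC.
Qed.

(** The expected squared norm of the posterior at stage [n], which measures the
    information on the state that has been revealed. *)
Definition information tau n :=
  \sum_(h : n.-tuple A) marginal h * likII tau h * \sum_k post h k ^+ 2.

Lemma information_le1 tau n : information tau n <= 1.
Proof.
rewrite -(sum_marginal_likII tau n); apply: ler_sum => h _.
rewrite ler_piMr ?mulr_ge0 ?marginal_ge0 ?likII_ge0 //.
rewrite -(dist_sum1 (post h)); apply: ler_sum => k _.
rewrite expr2 ler_piMr ?dist_ge0 // -(dist_sum1 (post h)) (bigD1 k) //=.
by rewrite lerDl sumr_ge0 // => *; exact: dist_ge0.
Qed.

(** The posteriors form a martingale, whose increments are orthogonal: the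
    expected squared norm of the posterior grows by the expected square of the
    increment. *)
Lemma information_gain tau N n : (N <= n)%N ->
  \sum_(h : n.-tuple A) marginal h * likII tau h *
    (\sum_k (post h k - post (take N h) k) ^+ 2) =
  information tau n - information tau N.
Proof.
move=> Nn.
(* after expanding the squares, G collects the terms that involve the posterior
   at stage N; it is a martingale from stage N on *)
pose G h := \sum_k (2 * post (take N h) k * (joint k h * likII tau h) -
  post (take N h) k ^+ 2 * (marginal h * likII tau h)).
have GE : \sum_(h : n.-tuple A) G h = information tau N.
  rewrite (sum_tuple_martingale (N := N)) // => [|h Nh].
    apply: eq_bigr => h _; rewrite mulr_sumr; apply: eq_bigr => k _.
    by rewrite take_oversize ?size_tuple // -postE; ring.
  rewrite exchange_big; apply: eq_bigr => k _ /=.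
  under eq_bigr do rewrite -cats1 takel_cat //.
  rewrite sumrB -!mulr_sumr; congr (_ * _ - _ * _).
    by rewrite -sum_joint_likII_rcons; apply: eq_bigr => x _; rewrite cats1.
  by rewrite -sum_marginal_likII_rcons; apply: eq_bigr => x _; rewrite cats1.
rewrite -GE -sumrB; apply: eq_bigr => h _.
rewrite !mulr_sumr -sumrB; apply: eq_bigr => k _.
by rewrite -postE; ring.
Qed.

Lemma eq_information tau tau' N :
  (forall h, (size h < N)%N -> tau h = tau' h) ->
  information tau N = information tau' N.
Proof.
move=> tt'; apply: eq_bigr => h _; congr (_ * _ * _).
by apply: eq_likelihood => e a; rewrite size_tuple => /tt' ->.
Qed.

(** The distance between the two laws at stage [n] is the expected distance
    between the posteriors at stages [n] and [N]. The inequality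
    [|x| <= x ^ 2 / c + c] bounds it by the information gained after stage [N]. *)
Lemma conceal_close tau N n (d c : R) : 0 < c -> (N <= n)%N ->
  information tau n - information tau N <= d ->
  \sum_k \sum_(h : n.-tuple A)
    `|fine (law p sigma tau (cyl k h)) - fine (law p (conceal N) tau (cyl k h))|
  <= d / c + c * #|K|%:R.
Proof.
move=> c0 Nn dgain.
pose D h k := post h k - post (take N h) k.
have absD (x : R) : `|x| <= x ^+ 2 / c + c.
  have [xc|/ltW cx] := leP `|x| c.
    by apply: le_trans xc _; rewrite lerDr divr_ge0 ?sqr_ge0 // ltW.
  apply: (@le_trans _ _ (x ^+ 2 / c)); last by rewrite lerDl ltW.
  by rewrite ler_pdivlMr // -real_normK ?num_real // expr2 ler_wpM2l.
rewrite exchange_big /=.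
apply: (@le_trans _ _ (\sum_(h : n.-tuple A) (marginal h * likII tau h *
    (\sum_k D h k ^+ 2) / c + marginal h * likII tau h * (c * #|K|%:R)))).
  apply: ler_sum => h _.
  have -> : marginal h * likII tau h * (\sum_k D h k ^+ 2) / c +
      marginal h * likII tau h * (c * #|K|%:R) =
      \sum_k marginal h * likII tau h * (D h k ^+ 2 / c + c).
    by rewrite -mulr_sumr big_split /= -mulr_suml sumr_const mulr_natr mulrDr mulrA.
  apply: ler_sum => k _; rewrite !law_cyl /= joint_conceal ?size_tuple //.
  rewrite -/(joint k h) -postE -mulrBl -mulrBr mulrAC normrM.
  rewrite ger0_norm ?mulr_ge0 ?marginal_ge0 ?likII_ge0 //.
  by rewrite ler_wpM2l ?mulr_ge0 ?marginal_ge0 ?likII_ge0.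
rewrite big_split /= -!mulr_suml sum_marginal_likII mul1r lerD2r.
by rewrite information_gain // ler_wpM2r // invr_ge0 ltW.
Qed.

End posterior.

(** * The upper bound *)

Section upper_bound.
Variables (R : realType) (K I J : pfinType) (f : play K I J -> R) (M : R).
Hypotheses (mf : measurable_fun setT f) (fM : forall x, `|f x| <= M).
Hypothesis tail_f : tail_measurable f.
Local Notation A := (I * J)%type.

Lemma continue_continue (S : pfinType) N (g h : seq A) (s : seq A -> dist R S) :
  size g = N -> continue N g (continue N h s) = continue N h s.
Proof.
move=> gN; apply/funext => e; rewrite {1 3}/continue; case: ltnP => // Ne.
by rewrite /continue size_cat gN ltnNge leq_addr /= (drop_size_cat _ gN).
Qed.

(** In the continuation game after [h], Player I's strategy is non-revealing, so
    Player II has a reply [tau] that brings the payoff below [u + e] in the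
    non-revealing game. This reply may use the actions of the first [N] stages,
    that are absent from the continuation game; but the payoff of [tau] is an
    average over these actions [g], so some fixed [g] does at least as well. *)
Lemma continuation_reply (q : dist R K) (a : nr_strategyI R I J) N (h : seq A)
    (e : R) : size h = N -> 0 < e ->
  exists tau : strategyII R I J,
    (nr_payoff q f (continue N h a) (continue N h tau) <= (nr_value q f + e)%:E)%E.
Proof.
move=> hN e0; pose s := continue N h a.
have : (ereal_inf (range (nr_payoff q f s)) < (nr_value q f + e)%:E)%E.
  apply: (@le_lt_trans _ _ (nr_maxmin q f)).
    by apply: ereal_sup_ubound; exists s.
  by rewrite -(nr_valueE mf fM) lte_fin ltrDl.
move=> /ereal_inf_lt[_ [tau _ <-]].
rewrite /nr_payoff (continuation_payoff mf fM tail_f (N := N)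
  (m := fun g => likI s g * likII tau g) (q := fun=> q)); last 2 first.
- by move=> g; rewrite mulr_ge0 ?likI_ge0 ?likII_ge0.
- by move=> k g; rewrite mulrC mulrA.
pose v (g : N.-tuple A) := fine (payoff q f (fun=> s) (continue N g tau)).
rewrite (eq_bigr (fun g : N.-tuple A => (likI s g * likII tau g * v g)%:E)); last first.
  move=> g _; rewrite EFinM fineK ?(payoff_fin mf fM) //.
  by rewrite /s continue_continue // size_tuple.
rewrite sumEFin lte_fin => total_lt.
have [g vg] : exists g, v g <= nr_value q f + e.
  apply/not_existsP => vlt; move: total_lt; rewrite ltNge => /negP; apply.
  rewrite -[leLHS]mul1r -(sum_likI_likII s tau N) mulr_suml.
  apply: ler_sum => g _; apply: ler_wpM2l.
    by rewrite mulr_ge0 ?likI_ge0 ?likII_ge0.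
  by have /negP := vlt g; rewrite -ltNge => /ltW.
exists (fun e => tau (g ++ drop N e)).
have -> : continue N h (fun e => tau (g ++ drop N e)) = continue N g tau.
  by apply/funext => e'; rewrite /continue (drop_size_cat _ hN).
by rewrite -[leLHS]fineK ?(payoff_fin mf fM) // lee_fin.
Qed.

(** Knowing [sigma], Player II plays [tau1] during [N] stages, chosen so as to
    extract almost all the information that [sigma] can ever reveal. From then
    on [sigma] may be replaced with its average at a small cost, whatever Player
    II does, and Player II plays almost optimally against the average in the
    non-revealing game at the current posterior. *)
Lemma best_reply (p : dist R K) (sigma : strategyI R K I J) (e : R) : 0 < e ->
  exists tau, (payoff p f sigma tau <= (cav (fun q => nr_value q f) p + e)%:E)%E.
Proof.
move=> e0; pose u q := nr_value q f.
have M0 : 0 <= M by exact: le_trans (normr_ge0 _) (fM point).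
have [post postE] := posterior_ex p sigma.
have [sbar sbarE] := average_strategy_ex p sigma.
(* c and d are such that d / c + c * #|K| = e / 4 / (M + 1), which makes
   the cost of the replacement at most e / 2 *)
pose c := e / 8 / (M + 1) / #|K|%:R.
have K0 : 0 < #|K|%:R :> R by rewrite ltr0n; apply/card_gt0P; exists point.
have c0 : 0 < c by rewrite !divr_gt0 // ltr_wpDl.
pose d := c * (e / 8 / (M + 1)).
have d0 : 0 < d by rewrite mulr_gt0 // !divr_gt0 // ltr_wpDl.
pose S : set R := [set x | exists tau n, x = information p sigma post tau n].
have S1 : ubound S 1 by move=> _ [tau [n ->]]; exact: information_le1.
pose tau0 : strategyII R I J := fun=> dirac_dist R point.
have supS : has_sup S.
  by split; [exists (information p sigma post tau0 0), tau0, 0%N|exists 1].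
have [_ [tau1 [N ->]] info_gt] := sup_adherent d0 supS.
have /choice[reply replyP] (h : seq A) : exists tau : strategyII R I J,
    size h = N -> (nr_payoff (post h) f (continue N h sbar) (continue N h tau)
      <= (u (post h) + e / 2)%:E)%E.
  have [hN|hN] := eqVneq (size h) N; last by exists tau0 => /eqP; rewrite (negbTE hN).
  have [tau tauP] := continuation_reply (post h) sbar hN (divr_gt0 e0 (ltr0n _ 2)).
  by exists tau.
pose tau : strategyII R I J := fun h => if (size h < N)%N then tau1 h else reply (take N h) h.
exists tau.
have gain n : (N <= n)%N ->
    information p sigma post tau n - information p sigma post tau N <= d.
  move=> _; rewrite (@eq_information _ _ _ _ p sigma post tau tau1 N); last first.
    by move=> h hN; rewrite /tau hN.
  rewrite lerBlDr addrC -lerBlDr; apply: le_trans (ltW info_gt); rewrite lerB //.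
  by apply: ub_le_sup; [exists 1|exists tau, n].
apply: (@le_trans _ _ (payoff p f (conceal sigma sbar N) tau + (e / 2)%:E)%E).
  apply: (le_trans (expectation_close_on_cylinders (N := N)
    (Q := law p (conceal sigma sbar N) tau) (C := d / c + c * #|K|%:R) mf fM _)).
    by move=> n Nn; apply: (conceal_close postE sbarE) => //; exact: gain.
  rewrite leeD2l // lee_fin.
  have -> : d / c + c * #|K|%:R = e / 4 / (M + 1).
    by rewrite /d /c; field; rewrite !lt0r_neq0 // ltr_wpDl.
  rewrite [leLHS](_ : _ = (e / 2) * (M / (M + 1))); last first.
    by field; rewrite lt0r_neq0 // ltr_wpDl.
  rewrite ler_piMr ?divr_ge0 ?ltW // ltr_pdivrMr ?ltr_wpDl // mul1r ltrDl //.
have mge0 h : 0 <= marginal p sigma h * likII tau h.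
  by rewrite mulr_ge0 ?marginal_ge0 ?likII_ge0.
rewrite (continuation_payoff mf fM tail_f (N := N)
  (m := fun h => marginal p sigma h * likII tau h) (q := fun h => post h)) //; last first.
  move=> k h; rewrite (joint_conceal postE sbarE) ?size_tuple //.
  by rewrite take_oversize ?size_tuple // mulrAC.
have conceal_continue (h : N.-tuple A) :
    (fun k => continue N h (conceal sigma sbar N k)) = (fun=> continue N h sbar).
  apply/funext => k; apply/funext => g; rewrite /continue; case: ltnP => // _.
  by rewrite /conceal size_cat size_tuple ltnNge leq_addr.
have tau_continue (h : N.-tuple A) : continue N h tau = continue N h (reply h).
  apply/funext => g; rewrite /continue; case: ltnP => // _.
  rewrite /tau size_cat size_tuple ltnNge leq_addr /=.
  by rewrite take_size_cat ?size_tuple.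
apply: (@le_trans _ _ ((\sum_(h : N.-tuple A) marginal p sigma h * likII tau h *
    (cav u (post h) + e / 2))%:E + (e / 2)%:E)%E).
  rewrite leeD2r // -sumEFin; apply: lee_sum => h _.
  rewrite [leRHS]EFinM; apply: lee_wpmul2l; first by rewrite lee_fin.
  rewrite conceal_continue tau_continue.
  apply: le_trans (replyP h (size_tuple h)) _.
  rewrite lee_fin lerD2r.
  by have [_ + _] := cav_least (ex_intro _ M (nr_value_le mf fM)); apply.
rewrite -EFinD lee_fin.
under eq_bigr do rewrite mulrDr.
rewrite big_split /= -mulr_suml sum_marginal_likII mul1r -addrA -splitr lerD2r.
rewrite -[leRHS]mul1r -(sum_marginal_likII p sigma tau N).
apply: concave_jensen => //.
  by have [] := cav_least (ex_intro _ M (nr_value_le mf fM)).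
move=> k; rewrite sum_marginal_likII mul1r -(sum_joint_likII p sigma k tau N).
by apply: eq_bigr => h _; rewrite -postE mulrAC.
Qed.

Lemma maxmin_le_cav p : (maxmin p f <= (cav (fun q => nr_value q f) p)%:E)%E.
Proof.
apply: ge_ereal_sup => _ [sigma _ <-]; apply/lee_addgt0Pr => e e0.
have [tau tauP] := best_reply p sigma e0.
by apply: le_trans tauP; apply: ereal_inf_lbound; exists tau.
Qed.

End upper_bound.

Theorem theorem2p5 (R : realType) (K I J : pfinType) (f : play K I J -> R)
    (bounded_f : exists M : R, forall x : play K I J, `|f x| <= M)
    (measurable_f : measurable_fun [set: play K I J] f)
    (tail_f : tail_measurable f) :
  forall p : dist R K,
    maxmin p f = (cav (fun q : dist R K => nr_value q f) p)%:E.
Proof.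
move=> p; have [M fM] := bounded_f; apply/le_anti/andP; split.
  exact: maxmin_le_cav fM tail_f p.
exact: cav_le_maxmin fM p.
Qed.
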